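(* Let $k\ge1$ and let $\{(X_n,Y_n);\,n\ge -k+1\}$ be an irreducible and aperiodic (time-homogeneous) Markov chain of memory length $k$ on the finite alphabet $A\times B$, with an arbitrary initial distribution for $(X_{-k+1}^0,Y_{-k+1}^0)$. Let $\{(\bar X_n,\bar Y_n)\}$ be its stationary version and $\hat I_n^{(k)}(\boldsymbol X\to\boldsymbol Y)$ the plug-in estimator. Then, as $n\to\infty$, $$\hat I_n^{(k)}(\boldsymbol X\to\boldsymbol Y)-I(\bar Y_0;\bar X_{-k}^0\mid\bar Y_{-k}^{-1})=O\left(\sqrt{\frac{\log\log n}{n}}\right)\quad\text{a.s.},$$ $$E\left[\big|\hat I_n^{(k)}(\boldsymbol X\to\boldsymbol Y)-I(\bar Y_0;\bar X_{-k}^0\mid\bar Y_{-k}^{-1})\big|\right]=O\left(\frac1{\sqrt n}\right).$$ If, moreover, $\{Y_n\}$ is also a Markov chain of memory no larger than $k$, then, as $n\to\infty$, $$\hat I_n^{(k)}(\boldsymbol X\to\boldsymbol Y)-I(\boldsymbol X\to\boldsymbol Y)=O\left(\sqrt{\frac{\log\log n}{n}}\right)\quad\text{a.s.},$$ $$E\left[\big|\hat I_n^{(k)}(\boldsymbol X\to\boldsymbol Y)-I(\boldsymbol X\to\boldsymbol Y)\big|\right]=O\left(\frac1{\sqrt n}\right),$$ where $I(\boldsymbol X\to\boldsymbol Y)$ is the directed information rate.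
   Context: Notation: $\log$ is the natural logarithm; $x_i^j=(x_i,\dots,x_j)$; $H(\cdot)$, $H(\cdot|\cdot)$ and $I(\cdot;\cdot|\cdot)$ are Shannon entropy, conditional entropy and conditional mutual information of finite-valued random variables. In the almost-sure statements the implied constant may be random. Markov chain of memory length $k$: the conditional distribution of the next value given the whole past depends only on the last $k$ values (so the true order may be smaller than $k$). Irreducible and aperiodic: the first-order chain of $k$-blocks $(X_{n-k+1}^n,Y_{n-k+1}^n)$, $n\ge0$, is irreducible and aperiodic on its state space (the set of $k$-blocks in $(A\times B)^k$ that it visits with positive probability). Stationary version: $\{(\bar X_n,\bar Y_n)\}$ is the stationary process (extended to all $n\in\mathbb Z$) with the same transition probabilities, where $(\bar X_{-k+1}^0,\bar Y_{-k+1}^0)$ has the unique invariant distribution. Directed information: $I(X_1^n\to Y_1^n)=H(Y_1^n)-\sum_{i=1}^n H(Y_i|Y_1^{i-1},X_1^i)$. Directed information rate: $I(\boldsymbol X\to\boldsymbol Y)=\lim_{n\to\infty}\frac1n I(X_1^n\to Y_1^n)$ (the limit exists under the stated assumptions). Plug-in estimator: from the sample $(X_{-k+1}^n,Y_{-k+1}^n)$ form the empirical distribution on $A^{k+1}\times B^{k+1}$, $$\hat P_{X_{-k}^0Y_{-k}^0,n}(a_0^k,b_0^k)=\frac1n\sum_{i=1}^n\mathbb I_{\{X_{i-k}^i=a_0^k,\;Y_{i-k}^i=b_0^k\}},$$ and set $\hat I_n^{(k)}(\boldsymbol X\to\boldsymbol Y)=I(\hat Y_0;\hat X_{-k}^0\mid\hat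 Y_{-k}^{-1})$ where $(\hat X_{-k}^0,\hat Y_{-k}^0)\sim\hat P_{X_{-k}^0Y_{-k}^0,n}$. *)

(* Defs.v *)
From mathcomp Require Import all_boot all_order all_algebra.
From mathcomp Require Import all_classical all_reals all_analysis.

Set Implicit Arguments.
Unset Strict Implicit.
Unset Printing Implicit Defensive.

Import Order.TTheory GRing.Theory Num.Theory.
Import numFieldNormedType.Exports.

Local Open Scope classical_set_scope.
Local Open Scope ring_scope.

(** Information quantities (in nats) of probability mass functions on finite
    types.  The conventions [ln 0 = 0] and [x / 0 = 0] implement
    [0 log 0 = 0]. *)
Section Information.
Context {R : realType}.

Definition entropy (T : finType) (p : T -> R) : R :=
  - \sum_t p t * ln (p t).

(** [H(U | V)] for [(U, V)] distributed according to [p]. *)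
Definition cond_entropy (U V : finType) (p : U * V -> R) : R :=
  - \sum_(x : U * V) p x * ln (p x / \sum_(u : U) p (u, x.2)).

(** [I(U; V | W) = H(U | W) - H(U | V, W)] for [(U, V, W)] distributed
    according to [p]. *)
Definition cond_mutual_info (U V W : finType) (p : U * (V * W) -> R) : R :=
  cond_entropy (fun x : U * W => \sum_(v : V) p (x.1, (v, x.2)))
  - cond_entropy p.

End Information.

(** Processes are indexed by [int]; a one-sided process started at time [s]
    is such a function of which only the values at times [n >= s] are used. *)
Section Paths.
Context {Omega : Type}.

(** [window V s l] is the block [(V_s, ..., V_(s+l-1))]. *)
Definition window (C : Type) (V : int -> Omega -> C) (s : int) (l : nat)
    (w : Omega) : l.-tuple C :=
  [tuple V (s + i%:Z) w | i < l].

Definition pair_process (A B : Type) (X : int -> Omega -> A)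
    (Y : int -> Omega -> B) : int -> Omega -> A * B :=
  fun n w => (X n w, Y n w).

End Paths.

Section Processes.
Context {d : measure_display} {Omega : measurableType d} {R : realType}.

Definition law (P : probability Omega R) (T : Type) (V : Omega -> T) (t : T)
    : R :=
  fine (P (V @^-1` [set t])).

(** [V_s, V_(s+1), ...] is a Markov chain of memory length [k]: whenever the
    past [(V_s, ..., V_(s+l+k-1)) = u ++ v], with [v] of length [k], has
    positive probability, the conditional probability that the next value is
    [c] is [q l v c], which does not depend on [u].  The chain is
    time-homogeneous when [q] does not depend on [l]. *)
Definition markov_from (P : probability Omega R) (C : finType) (k : nat)
    (q : nat -> k.-tuple C -> C -> R) (V : int -> Omega -> C) (s : int)
    : Prop :=
  forall (l : nat) (u : l.-tuple C) (v : k.-tuple C) (c : C),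
    law P (window V s (l + k)) [tuple of u ++ v] != 0 ->
    law P (window V s (l + k).+1) [tuple of rcons (u ++ v) c]
      / law P (window V s (l + k)) [tuple of u ++ v] = q l v c.

(** The state space of the chain of [k]-blocks [V_(n-k+1), ..., V_n], for
    [n >= 0]. *)
Definition visited (P : probability Omega R) (C : finType) (k : nat)
    (V : int -> Omega -> C) : set (k.-tuple C) :=
  [set v | exists n : nat, 0 < law P (window V (n%:Z - k%:Z + 1) k) v].

Definition stationary (P : probability Omega R) (C : finType)
    (V : int -> Omega -> C) : Prop :=
  forall (s : int) (l : nat) (v : l.-tuple C),
    law P (window V s l) v = law P (window V 0 l) v.

End Processes.

Section BlockChain.
Context {R : realType} (C : finType) (k : nat).
Implicit Types (Q : k.-tuple C -> C -> R) (S : set (k.-tuple C)).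

Definition transition_probabilities Q : Prop :=
  (forall v c, 0 <= Q v c) /\ (forall v, \sum_c Q v c = 1).

(** Transition matrix of the first-order chain of [k]-blocks: emitting [c]
    moves [v_1 ... v_k] to [v_2 ... v_k c]. *)
Definition block_kernel Q (v v' : k.-tuple C) : R :=
  \sum_(c | v' == [tuple of behead (rcons v c)]) Q v c.

Fixpoint block_kernel_iter Q (n : nat) (v v' : k.-tuple C) : R :=
  if n is m.+1
  then \sum_(x : k.-tuple C) block_kernel Q v x * block_kernel_iter Q m x v'
  else (v == v')%:R.

Definition irreducible_on Q S : Prop :=
  forall v v', S v -> S v' -> exists n : nat, 0 < block_kernel_iter Q n v v'.

(** The greatest common divisor of the return times to any state is 1. *)
Definition aperiodic_on Q S : Prop :=
  forall v, S v -> forall m : nat,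
    (forall n : nat, (0 < n)%N -> 0 < block_kernel_iter Q n v v -> (m %| n)%N) ->
    m = 1%N.

(** The support condition is what makes the invariant distribution unique:
    [Q] is also defined, arbitrarily, at blocks outside the state space [S]. *)
Definition invariant_distribution Q S (p : k.-tuple C -> R) : Prop :=
  [/\ forall v, 0 <= p v,
      \sum_v p v = 1,
      forall v, ~ S v -> p v = 0 &
      forall v', \sum_v p v * block_kernel Q v v' = p v'].

End BlockChain.

(** [V] is the (two-sided) stationary version of a chain with transition
    probabilities [Q] and state space of blocks [S]. *)
Definition stationary_version {d : measure_display} {Omega : measurableType d}
    {R : realType} (P : probability Omega R) (C : finType) (k : nat)
    (Q : k.-tuple C -> C -> R) (S : set (k.-tuple C)) (V : int -> Omega -> C)
    : Prop :=
  [/\ forall (n : int) (c : C), measurable (V n @^-1` [set c]),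
      stationary P V,
      forall s : int, markov_from P (fun _ => Q) V s &
      invariant_distribution Q S (law P (window V (1 - k%:Z) k))].

Section DirectedInformation.
Context {d : measure_display} {Omega : measurableType d} {R : realType}.
Variables (P : probability Omega R) (A B : finType).
Variables (X : int -> Omega -> A) (Y : int -> Omega -> B).

(** [I(X_1^n -> Y_1^n)] *)
Definition directed_info (n : nat) : R :=
  entropy (law P (window Y 1 n))
  - \sum_(1 <= i < n.+1)
      cond_entropy (law P (fun w =>
        (Y i%:Z w, (window Y 1 i.-1 w, window X 1 i w)))).

Definition directed_info_mean : nat -> R := fun n => directed_info n / n%:R.

Definition directed_info_rate : R := limn directed_info_mean.

(** [I(Y_0; X_(-k)^0 | Y_(-k)^(-1))] *)
Definition cond_info0 (k : nat) : R :=
  cond_mutual_info (law P (fun w =>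
    (Y 0 w, (window X (- k%:Z) k.+1 w, window Y (- k%:Z) k w)))).

End DirectedInformation.

Section PlugIn.
Context {R : realType} {Omega : Type}.
Variables (A B : finType) (X : int -> Omega -> A) (Y : int -> Omega -> B).

(** The empirical distribution of [(X_(i-k)^i, Y_(i-k)^i)], [1 <= i <= n]. *)
Definition empirical (k n : nat) (w : Omega)
    (ab : k.+1.-tuple A * k.+1.-tuple B) : R :=
  n%:R^-1 * \sum_(1 <= i < n.+1)
    ((window X (i%:Z - k%:Z) k.+1 w == ab.1)
     && (window Y (i%:Z - k%:Z) k.+1 w == ab.2))%:R.

Definition plugin (k n : nat) (w : Omega) : R :=
  cond_mutual_info (fun t : B * (k.+1.-tuple A * k.-tuple B) =>
    empirical n w (t.2.1, [tuple of rcons t.2.2 t.1])).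

End PlugIn.

(* Main.v *)
(** The plug-in estimator and its limit are the same functional [I(U; V | W)] of
    two pmfs, the empirical one and the stationary one [p0].  This functional is
    a combination of entropies of marginals, and [a ln a] is Lipschitz at every
    [a0 > 0], so it is Lipschitz in l1 at [p0] among the pmfs absolutely
    continuous with respect to [p0]; it remains to bound the deviations of the
    empirical frequencies.

    The chain of [k]-blocks satisfies a Doeblin condition (irreducible and
    aperiodic, finite).  Solving the Poisson equation turns the centred sum
    [\sum_(i < n) f(Z_i, Z_(i+1)) - n mu] into a martingale with bounded
    increments plus a bounded term.  Orthogonality of the increments gives the
    [L1] rate; the exponential supermartingale, Ville's inequality and
    Borel-Cantelli along dyadic blocks give the almost sure rate.

    For the directed information rate, the increment of [I(X_1^n -> Y_1^n)] at a
    time [t > k] is exactly [I(Y_t; X_(t-k)^t | Y_(t-k)^(t-1))] by the two Markov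
    properties; the law of the block at time [t] converges to the stationary one,
    and a Cesaro mean concludes. *)

Require Import Defs.
From mathcomp Require Import all_boot all_order all_algebra.
From mathcomp Require Import all_classical all_reals all_analysis.
From mathcomp Require Import measurable_realfun ring lra zify.

Set Implicit Arguments.
Unset Strict Implicit.
Unset Printing Implicit Defensive.

Import Order.TTheory GRing.Theory Num.Theory.
Import numFieldNormedType.Exports.

Local Open Scope classical_set_scope.
Local Open Scope ring_scope.

(** * Information quantities *)

(** Two obstacles shape the proof. Since [a * ln a] has infinite slope at 0, an l1 bound on
    frequencies controls the information only if the empirical law charges nothing outside the
    support of the stationary one. This holds almost surely for any initial distribution, because
    irreducibility on the visited blocks gives each of them positive invariant mass. Moreover [Q] is
    arbitrary at unvisited blocks, where the block chain may be reducible; replacing those rows by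
    the invariant law gives Doeblin's condition at every block without changing the process.

    A block of length [k + 1] is read as a pair of consecutive [k]-blocks, which is why averages are
    taken of functions [f x y] of a transition. No conditional expectation is formed: a
    finite-valued history [H n] plays the filtration, and means of path functionals become the
    finite recursion [path_mean], on which the martingale inequalities are proved. *)

Section InformationBounds.
Context {R : realType}.

Lemma sum_pairE (I J : finType) (F : I * J -> R) :
  \sum_x F x = \sum_i \sum_j F (i, j).
Proof. by rewrite pair_bigA; apply: eq_bigr => -[]. Qed.

(** Only [a0] has to stay away from 0: in [a * (ln a - ln a0)] the factor [a] cancels the [a^-1]
    coming from [ln a0 - ln a <= (a0 - a) / a], so one constant serves all [a] in [[0, N]]. *)
Lemma mul_ln_lipschitz (N a0 a : R) : 0 < a0 -> 0 <= a -> a <= N ->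
  `|a * ln a - a0 * ln a0| <= (`|ln a0| + N / a0 + 1) * `|a - a0|.
Proof.
move=> a0_gt0 a_ge0 aN.
have split_diff : a * ln a - a0 * ln a0 = ln a0 * (a - a0) + a * (ln a - ln a0).
  by ring.
rewrite split_diff (le_trans (ler_normD _ _)) // -addrA mulrDl normrM lerD2l.
have [->|a_neq0] := eqVneq a 0.
  rewrite mul0r normr0 mulr_ge0 //.
  by rewrite addr_ge0 // divr_ge0 ?(le_trans a_ge0 aN) // ltW.
have a_gt0 : 0 < a by rewrite lt_def a_neq0.
have ln_ratio (x y : R) : 0 < x -> 0 < y -> ln x - ln y <= (x - y) / y.
  move=> x0 y0; rewrite -ln_div ?posrE //.
  have -> : x / y = 1 + (x - y) / y by field; rewrite gt_eqF.
  apply: le_ln1Dx.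
  have -> : (x - y) / y = x / y - 1 by field; rewrite gt_eqF.
  by rewrite ltrBrDl subrr divr_gt0.
have upper : a * (ln a - ln a0) <= N / a0 * `|a - a0|.
  apply: (@le_trans _ _ (a * ((a - a0) / a0))).
    by rewrite ler_pM2l // ln_ratio.
  rewrite mulrA mulrAC; apply: (@le_trans _ _ (a / a0 * `|a - a0|)).
    by rewrite ler_wpM2l ?ler_norm // divr_ge0 // ltW.
  by rewrite ler_wpM2r // ler_wpM2r // invr_ge0 ltW.
have lower : - (a * (ln a - ln a0)) <= `|a - a0|.
  rewrite -mulrN opprB distrC; apply: (le_trans _ (ler_norm _)).
  apply: (@le_trans _ _ (a * ((a0 - a) / a))); first by rewrite ler_pM2l // ln_ratio.
  by rewrite mulrC divfK.
have Na0 : 0 <= N / a0 * `|a - a0|.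
  by rewrite mulr_ge0 // divr_ge0 ?(le_trans a_ge0 aN) // ltW.
have := normr_ge0 (a - a0) => norm0.
rewrite ler_norml mulrDl mul1r lerNl; apply/andP; split; lra.
Qed.

(** [m j] lists the outcomes summed into the [j]-th value of a marginal, so that all four entropies
    of a conditional mutual information are instances. Repetitions are allowed, hence the crude
    factor [#|I|]. *)
Lemma entropy_marginal_lipschitz (T J I : finType) (m : J -> I -> T)
    (p0 : T -> R) : (forall t, 0 <= p0 t) ->
  exists2 C : R, 0 <= C & forall p : T -> R, (forall t, 0 <= p t <= 1) ->
    (forall t, p0 t = 0 -> p t = 0) ->
    `|entropy (fun j => \sum_i p (m j i)) - entropy (fun j => \sum_i p0 (m j i))|
      <= C * \sum_t `|p t - p0 t|.
Proof.
move=> p0_ge0; pose N : R := #|I|%:R.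
pose c j : R := `|ln (\sum_i p0 (m j i))| + N / (\sum_i p0 (m j i)) + 1.
have c_ge0 j : 0 <= c j.
  by rewrite addr_ge0 // addr_ge0 // divr_ge0 // sumr_ge0.
exists (\sum_j c j * N); first by apply: sumr_ge0 => j _; rewrite mulr_ge0.
move=> p p01 supp; rewrite /entropy opprK addrC -sumrB.
rewrite (le_trans (ler_norm_sum _ _ _)) // mulr_suml ler_sum // => j _.
set a := \sum_i p _; set a0 := \sum_i p0 _.
have a_ge0 : 0 <= a by apply: sumr_ge0 => i _; case/andP: (p01 (m j i)).
have a0_ge0 : 0 <= a0 by apply: sumr_ge0.
have dist : `|a - a0| <= N * \sum_t `|p t - p0 t|.
  rewrite /a /a0 -sumrB (le_trans (ler_norm_sum _ _ _)) //.
  rewrite /N -sum1_card natr_sum mulr_suml ler_sum // => i _.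
  by rewrite mul1r (bigD1 (m j i)) //= lerDl sumr_ge0.
(* Where the reference marginal vanishes no Lipschitz bound is available; the support condition
   makes the other marginal vanish too. *)
have [a00|a0_neq0] := eqVneq a0 0.
  have -> : a = 0.
    rewrite /a big1 // => i _; apply: supp.
    by apply: (psumr_eq0P _ a00).
  rewrite a00 !mul0r subrr normr0 !mulr_ge0 //; exact: sumr_ge0.
rewrite -mulrA distrC.
apply: (le_trans (mul_ln_lipschitz (N := N) _ a_ge0 _)).
- by rewrite lt_def a0_neq0.
- rewrite /N -sum1_card natr_sum ler_sum // => i _.
  by case/andP: (p01 (m j i)).
- exact: (ler_wpM2l (c_ge0 j) dist).
Qed.

Lemma cond_entropyE (U V : finType) (p : U * V -> R) : (forall x, 0 <= p x) ->
  cond_entropy p = entropy p - entropy (fun v => \sum_u p (u, v)).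
Proof.
move=> p_ge0; rewrite /cond_entropy /entropy.
apply: oppr_inj; rewrite opprB !opprK [X in - X + _](_ : _ =
    \sum_(x : U * V) p x * ln (\sum_u p (u, x.2))); last first.
  under eq_bigr do rewrite mulr_suml.
  by rewrite exchange_big /= pair_bigA /=; apply: eq_bigr => -[].
rewrite addrC -sumrB; apply: eq_bigr => -[u v] _ /=.
have [->|px0] := eqVneq (p (u, v)) 0; first by rewrite !mul0r subr0.
have px_gt0 : 0 < p (u, v) by rewrite lt_def px0 p_ge0.
rewrite -mulrBr ln_div ?posrE //.
by rewrite (bigD1 u) //= ltr_wpDr // sumr_ge0.
Qed.

Lemma cond_mutual_infoE (U V W : finType) (p : U * (V * W) -> R) :
  (forall x, 0 <= p x) ->
  cond_mutual_info p =
    entropy (fun x : U * W => \sum_v p (x.1, (v, x.2)))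
    - entropy (fun w => \sum_(x : U * V) p (x.1, (x.2, w)))
    - (entropy p - entropy (fun vw => \sum_u p (u, vw))).
Proof.
move=> p_ge0; rewrite /cond_mutual_info !cond_entropyE //; last first.
  by move=> x; apply: sumr_ge0.
congr (_ - _ - _); congr entropy; apply/funext => w /=.
by rewrite pair_bigA.
Qed.

Lemma cond_mutual_info_lipschitz (U V W : finType) (p0 : U * (V * W) -> R) :
  (forall t, 0 <= p0 t) ->
  exists2 C : R, 0 <= C & forall p, (forall t, 0 <= p t <= 1) ->
    (forall t, p0 t = 0 -> p t = 0) ->
    `|cond_mutual_info p - cond_mutual_info p0| <= C * \sum_t `|p t - p0 t|.
Proof.
move=> p0_ge0.
have [C1 C1_ge0 H1] := entropy_marginal_lipschitz
  (fun (x : U * W) v => (x.1, (v, x.2))) p0_ge0.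
have [C2 C2_ge0 H2] := entropy_marginal_lipschitz
  (fun w (x : U * V) => (x.1, (x.2, w))) p0_ge0.
(* The joint law is its own marginal, with fibres indexed by [unit]. *)
have [C3 C3_ge0 H3] := entropy_marginal_lipschitz
  (fun t (_ : unit) => t) p0_ge0.
have [C4 C4_ge0 H4] := entropy_marginal_lipschitz
  (fun (vw : V * W) (u : U) => (u, vw)) p0_ge0.
exists (C1 + C2 + C3 + C4); first by rewrite !addr_ge0.
move=> p p01 supp; have p_ge0 t : 0 <= p t by case/andP: (p01 t).
rewrite !cond_mutual_infoE //.
move: (H1 p p01 supp) (H2 p p01 supp) (H3 p p01 supp) (H4 p p01 supp).
have sum_unit (q : U * (V * W) -> R) : (fun t => \sum_(i : unit) q t) = q.
  by apply/funext => t; rewrite big_const card_unit /= addr0.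
rewrite !sum_unit; rewrite !mulrDl !ler_norml.
move=> /andP[? ?] /andP[? ?] /andP[? ?] /andP[? ?].
by apply/andP; split; lra.
Qed.

(** [r u (phi v)] is the conditional probability of [u] given [v]. It sees [v] only through [phi v],
    so both sides are the mean of [- ln r]; points of mass 0 contribute nothing, whatever [r] is
    there. *)
Lemma cond_entropy_reduce (U V W : finType) (phi : V -> W) (p : U * V -> R)
    (q : U * W -> R) (r : U -> W -> R) :
  (forall x, 0 <= p x) ->
  (forall u w, q (u, w) = \sum_(v | phi v == w) p (u, v)) ->
  (forall u v, p (u, v) = r u (phi v) * \sum_u' p (u', v)) ->
  cond_entropy p = cond_entropy q.
Proof.
move=> p_ge0 qE pE; rewrite /cond_entropy; congr (- _).
have -> : \sum_(x : U * V) p x * ln (p x / \sum_u p (u, x.2)) =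
    \sum_(x : U * V) p x * ln (r x.1 (phi x.2)).
  apply: eq_bigr => -[u v] _ /=.
  have [->|pn0] := eqVneq (p (u, v)) 0; first by rewrite !mul0r.
  congr (_ * ln _); rewrite {1}pE mulfK //.
  by apply: contra_neq pn0; rewrite pE => ->; rewrite mulr0.
have margE w : \sum_u q (u, w) = \sum_(v | phi v == w) \sum_u p (u, v).
  by under eq_bigr do rewrite qE; rewrite exchange_big.
have qE' u w : q (u, w) = r u w * \sum_u' q (u', w).
  by rewrite margE mulr_sumr qE; apply: eq_bigr => v /eqP <-.
have -> : \sum_(x : U * W) q x * ln (q x / \sum_u q (u, x.2)) =
    \sum_(x : U * W) q x * ln (r x.1 x.2).
  apply: eq_bigr => -[u w] _ /=.
  have [->|qn0] := eqVneq (q (u, w)) 0; first by rewrite !mul0r.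
  congr (_ * ln _); rewrite {1}qE' mulfK //.
  by apply: contra_neq qn0; rewrite qE' => ->; rewrite mulr0.
rewrite !sum_pairE; apply: eq_bigr => u _; rewrite (partition_big phi predT) //=.
apply: eq_bigr => w _; rewrite qE mulr_suml.
by apply: eq_bigr => v /eqP ->.
Qed.

End InformationBounds.

(** * Finite Markov chains *)

Section FiniteChain.
Context {R : realType} {T : finType}.
Variable K : T -> T -> R.

Fixpoint kernel_iter (n : nat) (x y : T) : R :=
  if n is m.+1 then \sum_z K x z * kernel_iter m z y else (x == y)%:R.

Definition kernel_op (f : T -> R) (x : T) : R := \sum_y K x y * f y.

Definition osc_le (f : T -> R) (b : R) := forall x y, f x - f y <= b.

Lemma kernel_opE f x : kernel_op f x = \sum_y K x y * f y.
Proof. by []. Qed.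

Lemma iter_kernel_op n f x :
  iter n kernel_op f x = \sum_y kernel_iter n x y * f y.
Proof.
elim: n x => [|n IH] x /=.
  rewrite (bigD1 x) //= eqxx mul1r big1 ?addr0 // => y /negPf.
  by rewrite eq_sym => ->; rewrite mul0r.
rewrite kernel_opE.
under [LHS]eq_bigr do rewrite IH mulr_sumr.
rewrite exchange_big /=; apply: eq_bigr => y _; rewrite mulr_suml.
by apply: eq_bigr => z _; rewrite mulrA.
Qed.

Lemma kernel_iterD m n x y :
  kernel_iter (m + n) x y = \sum_z kernel_iter m x z * kernel_iter n z y.
Proof.
elim: m x => [|m IH] x.
  rewrite add0n (bigD1 x) //= eqxx mul1r big1 ?addr0 // => z /negPf.
  by rewrite eq_sym => ->; rewrite mul0r.
rewrite addSn /=; under [LHS]eq_bigr do rewrite IH mulr_sumr.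
rewrite exchange_big /=; apply: eq_bigr => z _; rewrite mulr_suml.
by apply: eq_bigr => u _; rewrite mulrA.
Qed.

Hypothesis K_ge0 : forall x y, 0 <= K x y.
Hypothesis K_sum1 : forall x, \sum_y K x y = 1.

Lemma kernel_iter_ge0 n x y : 0 <= kernel_iter n x y.
Proof.
elim: n x => [|n IH] x /=; first exact: ler0n.
by apply: sumr_ge0 => z _; rewrite mulr_ge0.
Qed.

Lemma kernel_iter_sum1 n x : \sum_y kernel_iter n x y = 1.
Proof.
have := iter_kernel_op n (fun=> 1) x.
under eq_bigr do rewrite mulr1.
move=> <-; elim: n x => [//|n IH] x /=.
by rewrite kernel_opE; under eq_bigr do rewrite IH mulr1; rewrite K_sum1.
Qed.

Lemma kernel_iterD_ge m n x z y :
  kernel_iter m x z * kernel_iter n z y <= kernel_iter (m + n) x y.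
Proof.
rewrite kernel_iterD (bigD1 z) //= lerDl sumr_ge0 // => u _.
by rewrite mulr_ge0 // kernel_iter_ge0.
Qed.

Variables (m : nat) (w0 : T) (eps : R).
Hypothesis eps_gt0 : 0 < eps.
Hypothesis doeblin : forall x, eps <= kernel_iter m x w0.

Let rho := 1 - eps ^+ 2.

Let rho_lt1 : rho < 1.
Proof. by rewrite /rho ltrBlDr ltrDl exprn_gt0. Qed.

Let rho_ge0 : 0 <= rho.
Proof.
rewrite /rho subr_ge0 expr_le1 ?(ltW eps_gt0) // (le_trans (doeblin w0)) //.
rewrite -(kernel_iter_sum1 m w0) (bigD1 w0) //= lerDl sumr_ge0 // => y _.
exact: kernel_iter_ge0.
Qed.

(* Coupling the two chains independently, they meet at [w0] at time [m] with
   probability at least [eps ^+ 2]. *)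
Lemma osc_le_contract f b : osc_le f b -> osc_le (iter m kernel_op f) (rho * b).
Proof.
move=> fb x y; rewrite !iter_kernel_op.
have b_ge0 : 0 <= b by have := fb w0 w0; rewrite subrr.
pose c (p : T * T) := kernel_iter m x p.1 * kernel_iter m y p.2.
have c_ge0 p : 0 <= c p by rewrite mulr_ge0 // kernel_iter_ge0.
have c_sum1 : \sum_p c p = 1.
  rewrite sum_pairE /c /=.
  under eq_bigr do rewrite -mulr_sumr kernel_iter_sum1 mulr1.
  exact: kernel_iter_sum1.
have -> : \sum_u kernel_iter m x u * f u - \sum_v kernel_iter m y v * f v =
    \sum_p c p * (f p.1 - f p.2).
  rewrite sum_pairE /c /=.
  under [RHS]eq_bigr do under eq_bigr do rewrite mulrBr.
  under [RHS]eq_bigr do rewrite sumrB.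
  rewrite sumrB; congr (_ - _).
    apply: eq_bigr => u _; rewrite -mulr_suml -mulr_sumr kernel_iter_sum1.
    by rewrite mulr1.
  rewrite exchange_big; apply: eq_bigr => v _; rewrite -mulr_suml -mulr_suml.
  by rewrite kernel_iter_sum1 mul1r.
rewrite (bigD1 (w0, w0)) //= subrr mulr0 add0r.
apply: (@le_trans _ _ ((1 - c (w0, w0)) * b)).
  rewrite -c_sum1 [X in (X - _) * b](bigD1 (w0, w0)) //= addrAC subrr add0r mulr_suml.
  by apply: ler_sum => p _; rewrite ler_wpM2l.
rewrite ler_wpM2r // /rho lerB // /c /= expr2.
by rewrite ler_pM // ?doeblin // ltW.
Qed.

Lemma osc_le_kernel_op f b : osc_le f b -> osc_le (kernel_op f) b.
Proof.
move=> fb x y; rewrite /kernel_op.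
have -> : \sum_u K x u * f u = \sum_u \sum_v K x u * K y v * f u.
  by apply: eq_bigr => u _; rewrite -mulr_suml -mulr_sumr K_sum1 mulr1.
have -> : \sum_v K y v * f v = \sum_u \sum_v K x u * K y v * f v.
  rewrite exchange_big; apply: eq_bigr => v _; rewrite -mulr_suml -mulr_suml.
  by rewrite K_sum1 mul1r.
rewrite -sumrB -[b]mul1r -[X in X * b](K_sum1 x) mulr_suml ler_sum // => u _.
rewrite -sumrB -[K x u in leRHS]mulr1 -(K_sum1 y) mulr_sumr mulr_suml.
by rewrite ler_sum // => v _; rewrite -mulrBr ler_wpM2l // mulr_ge0.
Qed.

(** Contraction is available at multiples of [m] only; in between, averaging does not increase the
    oscillation. *)
Lemma osc_le_iter_small f d : 0 < d ->
  exists N, forall n, (N <= n)%N -> osc_le (iter n kernel_op f) d.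
Proof.
move=> d0; pose b := (\sum_x `|f x|) *+ 2.
have fb : osc_le f b.
  move=> x y; have le1 z : `|f z| <= \sum_x `|f x|.
    by rewrite (bigD1 z) //= lerDl sumr_ge0.
  rewrite /b mulr2n (le_trans (ler_norm _)) //.
  by rewrite (le_trans (ler_normB _ _)) // lerD.
have geo j : osc_le (iter (j * m) kernel_op f) (rho ^+ j * b).
  elim: j => [|j IH]; first by rewrite mul0n expr0 mul1r.
  by rewrite mulSn iterD exprS -mulrA; exact: osc_le_contract.
have b_ge0 : 0 <= b by have := fb w0 w0; rewrite subrr.
(* [b + 1] avoids dividing by a bound that may be 0. *)
have /cvgrPdist_lt/(_ (d / (b + 1)))[] : (fun j => rho ^+ j) @ \oo --> (0 : R).
- by apply: cvg_expr; rewrite ger0_norm.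
- by rewrite divr_gt0 // ltr_wpDl.
move=> J _ /(_ J (leqnn J)) /=; rewrite sub0r normrN ger0_norm ?exprn_ge0 //.
move=> small; exists (J * m)%N => n /subnK <-.
elim: (n - J * m)%N => [|i IH]; last by rewrite addSn; exact: osc_le_kernel_op.
rewrite add0n => x y; apply: le_trans (geo J x y) _.
apply: (@le_trans _ _ (d / (b + 1) * b)); first by rewrite ler_wpM2r // ltW.
rewrite mulrAC ler_pdivrMr ?ltr_wpDl // ler_pM2l //; lra.
Qed.

(** A harmonic function equals all its iterates, whose oscillation tends to 0. *)
Lemma harmonic_const f : (forall x, kernel_op f x = f x) -> forall x y, f x = f y.
Proof.
move=> /funext harm.
have iterE n : iter n kernel_op f = f by elim: n => //= n ->.
suff le_f x y : f x <= f y by move=> x y; apply/eqP; rewrite eq_le !le_f.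
apply/ler_addgt0Pr => d d0; have [N /(_ N (leqnn N) x y)] := osc_le_iter_small f d0.
by rewrite iterE lerBlDl.
Qed.

Variable pi0 : T -> R.
Hypothesis pi_ge0 : forall x, 0 <= pi0 x.
Hypothesis pi_sum1 : \sum_x pi0 x = 1.
Hypothesis pi_inv : forall y, \sum_x pi0 x * K x y = pi0 y.

Lemma invariant_kernel_op f : \sum_x pi0 x * kernel_op f x = \sum_x pi0 x * f x.
Proof.
rewrite /kernel_op; under eq_bigr do rewrite mulr_sumr.
rewrite exchange_big; apply: eq_bigr => y _ /=.
by rewrite -pi_inv mulr_suml; apply: eq_bigr => x _; rewrite mulrA.
Qed.

(* [I - K + 1 pi] is injective, since it preserves the [pi]-mean and harmonic
   functions are constant; hence it is onto. *)
Lemma poisson_equation h : \sum_x pi0 x * h x = 0 ->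
  exists g, forall x, g x - kernel_op g x = h x.
Proof.
move=> pih.
have [n [ev [rank [evK rankK]]]] : exists n (ev : 'I_n -> T) (rank : T -> 'I_n),
    cancel ev rank /\ cancel rank ev.
  by exists #|T|, enum_val, enum_rank; split; [exact: enum_valK|exact: enum_rankK].
pose B : 'M[R]_n := \matrix_(i, j) ((i == j)%:R - K (ev j) (ev i)
  + pi0 (ev i)).
pose g (u : 'rV[R]_n) y := u 0 (rank y).
have BE (u : 'rV_n) x :
    (u *m B) 0 (rank x) = g u x - kernel_op (g u) x + \sum_y pi0 y * g u y.
  rewrite mxE /kernel_op; have reidx (F : T -> R) :
      \sum_y F y = \sum_(i < n) F (ev i).
    by rewrite (reindex ev) //; apply: onW_bij; by exists rank.
  have -> : g u x = \sum_(y : T) (y == x)%:R * g u y.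
    rewrite (bigD1 x) //= eqxx mul1r big1 ?addr0 // => y /negPf ->.
    by rewrite mul0r.
  rewrite !reidx -sumrB -big_split; apply: eq_bigr => i _ /=.
  rewrite mxE /g evK rankK.
  have -> : (i == rank x) = (ev i == x).
    by rewrite -(inj_eq (can_inj rankK)) evK.
  by ring.
have mean (u : 'rV_n) :
    \sum_x pi0 x * (u *m B) 0 (rank x) = \sum_x pi0 x * g u x.
  under eq_bigr do rewrite BE mulrDr mulrBr.
  rewrite big_split sumrB /= invariant_kernel_op subrr add0r -mulr_suml pi_sum1.
  by rewrite mul1r.
have Bunit : B \in unitmx.
  rewrite -row_free_unit; apply: inj_row_free => u uB.
  have := mean u; rewrite uB; under eq_bigr do rewrite mxE mulr0.
  rewrite big1 // => /esym mean0.
  have harm x : kernel_op (g u) x = g u x.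
    have := BE u x; rewrite uB mxE mean0 addr0 => /esym/eqP.
    by rewrite subr_eq0 => /eqP <-.
  apply/rowP => i; rewrite mxE -(evK i).
  rewrite -[LHS]mul1r -pi_sum1 mulr_suml -[RHS]mean0; apply: eq_bigr => x _.
  by congr (_ * _); exact: (harmonic_const harm).
pose u := (\row_i h (ev i)) *m invmx B.
have uB x : (u *m B) 0 (rank x) = h x.
  by rewrite mulmxKV // mxE rankK.
exists (g u) => x; rewrite -uB BE.
have := mean u; under eq_bigr do rewrite uB.
by rewrite pih => <-; rewrite addr0.
Qed.

(** By duality the [n] steps move from the law to the indicator of [y], whose iterate has small
    oscillation; the means of such a function under any two laws are close. *)
Lemma law_cvg_invariant (mu : nat -> T -> R) :
  (forall x, 0 <= mu 0%N x) -> \sum_x mu 0%N x = 1 ->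
  (forall n y, mu n.+1 y = \sum_x mu n x * K x y) ->
  forall y, mu n y @[n --> \oo] --> pi0 y.
Proof.
move=> mu0 mu1 muS y; pose f x : R := (x == y)%:R.
have pairing (nu : T -> R) : \sum_x nu x * f x = nu y.
  rewrite (bigD1 y) //= /f eqxx mulr1 big1 ?addr0 // => x /negPf ->.
  by rewrite mulr0.
have muE n g : \sum_x mu n x * g x = \sum_x mu 0%N x * iter n kernel_op g x.
  elim: n g => [//|n IH] g; rewrite iterSr -IH /kernel_op.
  under eq_bigr do rewrite muS mulr_suml.
  rewrite exchange_big; apply: eq_bigr => x _; rewrite mulr_sumr.
  by apply: eq_bigr => z _; rewrite mulrA.
have piE n g : \sum_x pi0 x * g x = \sum_x pi0 x * iter n kernel_op g x.
  by elim: n => [//|n ->]; rewrite iterS invariant_kernel_op.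
apply/cvgrPdist_le => e e0; have [N HN] := osc_le_iter_small f e0.
exists N => // n /= /HN osc.
rewrite -pairing -[mu n y]pairing (piE n) muE.
set F := iter n _ f in osc *.
have -> : \sum_x pi0 x * F x - \sum_x mu 0%N x * F x =
    \sum_x \sum_z pi0 x * mu 0%N z * (F x - F z).
  under [RHS]eq_bigr do under eq_bigr do rewrite mulrBr.
  under [RHS]eq_bigr do rewrite sumrB.
  rewrite sumrB; congr (_ - _).
    by apply: eq_bigr => x _; rewrite -mulr_suml -mulr_sumr mu1 mulr1.
  rewrite exchange_big; apply: eq_bigr => z _; rewrite -!mulr_suml pi_sum1.
  by rewrite mul1r.
rewrite (le_trans (ler_norm_sum _ _ _)) // -[e]mul1r -[X in X * e]pi_sum1.
rewrite mulr_suml ler_sum // => x _; rewrite (le_trans (ler_norm_sum _ _ _)) //.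
rewrite -[pi0 x in leRHS]mulr1 -mu1 mulr_sumr mulr_suml ler_sum // => z _.
rewrite normrM [X in X * _]ger0_norm ?mulr_ge0 // ler_wpM2l ?mulr_ge0 //.
by rewrite ler_norml lerNl opprB !osc.
Qed.

End FiniteChain.

(** * Martingale bounds on path space *)

Section PathMeasure.
Context {R : realType} {T : finType}.
Variables (K : T -> T -> R) (mu0 : T -> R).

(* The mean of [F Z_n [:: Z_(n-1); ...; Z_0]] for the chain [Z] with initial
   law [mu0] and kernel [K]. *)
Fixpoint path_mean (n : nat) (F : T -> seq T -> R) : R :=
  if n is m.+1 then path_mean m (fun x u => \sum_y K x y * F y (x :: u))
  else \sum_x mu0 x * F x [::].

Fixpoint path_sum (f : T -> T -> R) (x : T) (u : seq T) : R :=
  if u is z :: v then f z x + path_sum f z v else 0.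

Hypothesis K_ge0 : forall x y, 0 <= K x y.
Hypothesis K_sum1 : forall x, \sum_y K x y = 1.
Hypothesis mu0_ge0 : forall x, 0 <= mu0 x.
Hypothesis mu0_sum1 : \sum_x mu0 x = 1.

Lemma ler_path_mean n F G : (forall x u, size u = n -> F x u <= G x u) ->
  path_mean n F <= path_mean n G.
Proof.
elim: n F G => [|n IH] F G FG /=.
  by apply: ler_sum => x _; rewrite ler_wpM2l // FG.
by apply: IH => x u un; apply: ler_sum => y _; rewrite ler_wpM2l // FG //= un.
Qed.

Lemma eq_path_mean n F G : (forall x u, size u = n -> F x u = G x u) ->
  path_mean n F = path_mean n G.
Proof.
by move=> FG; apply/eqP; rewrite eq_le !ler_path_mean // => x u un; rewrite FG.
Qed.

Lemma path_meanD n F G :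
  path_mean n (fun x u => F x u + G x u) = path_mean n F + path_mean n G.
Proof.
elim: n F G => [|n IH] F G /=.
  by rewrite -big_split; apply: eq_bigr => x _; rewrite mulrDr.
rewrite -IH; apply: eq_path_mean => x u _.
by rewrite -big_split; apply: eq_bigr => y _; rewrite mulrDr.
Qed.

Lemma path_meanZ n a F : path_mean n (fun x u => a * F x u) = a * path_mean n F.
Proof.
elim: n F => [|n IH] F /=.
  by rewrite mulr_sumr; apply: eq_bigr => x _; rewrite mulrCA.
rewrite -IH; apply: eq_path_mean => x u _.
by rewrite mulr_sumr; apply: eq_bigr => y _; rewrite mulrCA.
Qed.

Lemma path_mean_cst n a : path_mean n (fun _ _ => a) = a.
Proof.
elim: n => [|n IH] /=; first by rewrite -mulr_suml mu0_sum1 mul1r.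
rewrite -[RHS]IH; apply: eq_path_mean => x u _.
by rewrite -mulr_suml K_sum1 mul1r.
Qed.

Section Martingale.
Variables (D : T -> T -> R) (c : R).
Hypothesis D_mean0 : forall x, \sum_y K x y * D x y = 0.
Hypothesis D_le : forall x y, `|D x y| <= c.

Lemma path_mean_sqr n :
  path_mean n (fun x u => path_sum D x u ^+ 2) <= c ^+ 2 * n%:R.
Proof.
elim: n => [|n IH] /=.
  by rewrite big1 ?mulr0 // => x _; rewrite expr0n mulr0.
have step x u : \sum_y K x y * (D x y + path_sum D x u) ^+ 2 <=
    path_sum D x u ^+ 2 + c ^+ 2.
  set M := path_sum D x u.
  (* Given the past, [M] is constant, so the cross term is a multiple of the conditional mean of
     [D], which is 0. *)
  have -> : \sum_y K x y * (D x y + M) ^+ 2 =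
      \sum_y K x y * D x y ^+ 2 + (M ^+ 2 + 2 * M * \sum_y K x y * D x y).
    rewrite -[M ^+ 2]mul1r -{1}(K_sum1 x) mulr_suml mulr_sumr -!big_split.
    by apply: eq_bigr => y _ /=; ring.
  rewrite D_mean0 mulr0 addr0 addrC lerD2l -[leRHS]mul1r -(K_sum1 x).
  rewrite mulr_suml ler_sum // => y _; rewrite ler_wpM2l //.
  by rewrite -[leLHS]real_normK ?num_real // lerXn2r // nnegrE // (le_trans _ (D_le x y)).
apply: le_trans (ler_path_mean (fun x u _ => step x u)) _.
rewrite path_meanD path_mean_cst -natr1 mulrDr mulr1 lerD2r; exact: IH.
Qed.

(** Young's inequality [|M| <= M ^+ 2 / (2 * a) + a / 2] takes the place of Cauchy-Schwarz; [a] is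
    chosen later as the square root of the number of steps. *)
Lemma path_mean_norm n (a : R) : 0 < a ->
  path_mean n (fun x u => `|path_sum D x u|) <= (c ^+ 2 * n%:R / a + a) / 2.
Proof.
move=> a0.
apply: (@le_trans _ _ (path_mean n (fun x u =>
    (2 * a)^-1 * path_sum D x u ^+ 2 + a / 2))).
  apply: ler_path_mean => x u _; rewrite -(real_normK (num_real (path_sum D x u))); set M := `|_|.
  rewrite -subr_ge0.
  have -> : (2 * a)^-1 * M ^+ 2 + a / 2 - M = (2 * a)^-1 * (M - a) ^+ 2.
    by field; rewrite gt_eqF.
  by rewrite mulr_ge0 ?sqr_ge0 // invr_ge0 mulr_ge0 // ltW.
rewrite path_meanD (path_meanZ _ (2 * a)^-1) path_mean_cst [leRHS]mulrDl lerD2r.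
have -> : c ^+ 2 * n%:R / a / 2 = (2 * a)^-1 * (c ^+ 2 * n%:R).
  by field; rewrite gt_eqF.
by rewrite ler_wpM2l ?path_mean_sqr // invr_ge0 mulr_ge0 // ltW.
Qed.

(** Invert [expR (- z) >= 1 - z]; the constant 2 and the threshold 1/2 come from [(1 + z + 2 * z ^+
    2) * (1 - z) = 1 + z ^+ 2 * (1 - 2 * z)]. *)
Lemma expR_le_quadratic (z : R) : z <= 2^-1 -> expR z <= 1 + z + 2 * z ^+ 2.
Proof.
move=> z_le; have := expR_ge1Dx (- z) => exp_ge.
have z1 : 0 < 1 - z by lra.
have -> : expR z = (expR (- z))^-1 by rewrite expRN invrK.
apply: (@le_trans _ _ (1 - z)^-1).
  by rewrite lef_pV2 ?posrE // (lt_le_trans z1).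
rewrite -div1r ler_pdivrMr // -subr_ge0.
have -> : (1 + z + 2 * z ^+ 2) * (1 - z) - 1 = z ^+ 2 * (1 - 2 * z) by ring.
by rewrite mulr_ge0 ?sqr_ge0 //; lra.
Qed.

Variables (lam a : R).
Hypothesis lam_ge0 : 0 <= lam.
Hypothesis lam_le : lam * c <= 2^-1.

(** The logarithm of the exponential supermartingale; its compensator, [2 * (lam * c) ^+ 2] per
    step, is the quadratic term of [expR_le_quadratic]. *)
Definition log_weight x u : R :=
  lam * path_sum D x u - 2 * (lam * c) ^+ 2 * (size u)%:R.

(** In the quadratic bound the linear term has mean 0; what is left, [1 + 2 * (lam * c) ^+ 2], is at
    most the exponential of the compensator. *)
Lemma expR_log_weight_le x u :
  \sum_y K x y * expR (log_weight y (x :: u)) <= expR (log_weight x u).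
Proof.
have split_weight y : expR (log_weight y (x :: u)) =
    expR (log_weight x u) * (expR (lam * D x y) * expR (- (2 * (lam * c) ^+ 2))).
  by rewrite -!expRD /log_weight /= -natr1; congr expR; ring.
under eq_bigr do rewrite split_weight mulrCA.
rewrite -mulr_sumr.
suff bound : \sum_y K x y * expR (lam * D x y) <= expR (2 * (lam * c) ^+ 2).
  under eq_bigr do rewrite mulrA.
  rewrite -mulr_suml ger_pMr ?expR_gt0 // expRN.
  by rewrite ler_pdivrMr ?expR_gt0 // mul1r.
apply: le_trans (expR_ge1Dx _).
apply: (@le_trans _ _ (\sum_y (K x y * (1 + 2 * (lam * c) ^+ 2)
    + lam * (K x y * D x y)))).
  apply: ler_sum => y _.
  have -> : K x y * (1 + 2 * (lam * c) ^+ 2) + lam * (K x y * D x y) =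
      K x y * (1 + lam * D x y + 2 * (lam * c) ^+ 2) by ring.
  rewrite ler_wpM2l //.
  have Dc := D_le x y; rewrite ler_norml in Dc; case/andP: Dc => Dc1 Dc2.
  apply: le_trans (expR_le_quadratic _) _.
    by apply: le_trans lam_le; rewrite ler_wpM2l.
  rewrite lerD2l ler_wpM2l // -[leLHS]real_normK ?num_real // normrM.
  rewrite (ger0_norm lam_ge0) lerXn2r ?nnegrE ?mulr_ge0 //.
    by rewrite (le_trans _ (D_le x y)).
  by rewrite ler_wpM2l.
rewrite big_split /= -mulr_suml K_sum1 mul1r -mulr_sumr D_mean0 mulr0 addr0.
exact: lexx.
Qed.

Fixpoint path_hits x u : bool :=
  (a <= log_weight x u) || (if u is z :: v then path_hits z v else false).

(* Ville's inequality, through the supermartingale stopped when it reaches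
   [expR a]. *)
Lemma path_hits_mean_le n : 0 < a ->
  path_mean n (fun x u => (path_hits x u)%:R) <= expR (- a).
Proof.
move=> a0.
pose W x u : R := if path_hits x u then 1 else expR (log_weight x u) * expR (- a).
have W_step x u : \sum_y K x y * W y (x :: u) <= W x u.
  have [hit|nohit] := boolP (path_hits x u).
    have W1 y : path_hits y (x :: u) -> W y (x :: u) = 1 by rewrite /W => ->.
    rewrite [leRHS]/W hit -[leRHS](K_sum1 x) ler_sum // => y _.
    by rewrite W1 /= ?hit ?orbT // mulr1.
  rewrite [leRHS]/W (negPf nohit).
  apply: le_trans (ler_wpM2r (expR_ge0 _) (expR_log_weight_le x u)).
  rewrite mulr_suml ler_sum // => y _; rewrite -mulrA ler_wpM2l // /W.
  case: ifP => //=; rewrite (negPf nohit) orbF => hit.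
  by rewrite -expRD -{1}expR0 ler_expR subr_ge0.
apply: (@le_trans _ _ (path_mean n W)).
  apply: ler_path_mean => x u _; rewrite /W; case: ifP => // _.
  by rewrite mulr_ge0 // expR_ge0.
elim: n => [|n IH] /=; last exact: le_trans (ler_path_mean (fun x u _ => W_step x u)) IH.
rewrite -[leRHS]mul1r -mu0_sum1 mulr_suml ler_sum // => x _; rewrite ler_wpM2l //.
rewrite /W /= orbF /log_weight /= !mulr0 subr0 (lt_geF a0).
by rewrite expR0 mul1r.
Qed.

End Martingale.

End PathMeasure.

(** * Finite-valued random variables *)

Section FiniteValued.
Context {d : measure_display} {Omega : measurableType d} {R : realType}.
Variable P : probability Omega R.

Lemma prob_fineK (E : set Omega) : measurable E -> (fine (P E))%:E = P E.
Proof. by move=> mE; rewrite fineK // fin_num_measure. Qed.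

Lemma law_ge0 (U : Type) (H : Omega -> U) u : 0 <= law P H u.
Proof. by rewrite /law fine_ge0. Qed.

Section Discrete.
Variables (U : finType) (H : Omega -> U).
Hypothesis mH : forall u, measurable (H @^-1` [set u]).

Lemma measurable_preimage_fin (E : set U) : measurable (H @^-1` E).
Proof.
rewrite (_ : _ @^-1` _ = \bigcup_(u in E) (H @^-1` [set u])).
  apply: fin_bigcup_measurable => // ; exact: finite_finset.
by apply/seteqP; split => [w Ew|w [u Eu /= ->//]]; exists (H w).
Qed.

(** A quantity that factors through a finite-valued variable has preimages that are unions of fibres
    of that variable; adaptedness is expressed throughout by such dependence. *)
Lemma measurable_determined (V : Type) (G : Omega -> V) (B : set V) :
  (forall w w', H w = H w' -> G w = G w') -> measurable (G @^-1` B).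
Proof.
move=> dep; rewrite (_ : _ @^-1` _ = H @^-1` (H @` (G @^-1` B))).
  exact: measurable_preimage_fin.
apply/seteqP; split => [w Bw|w [w' Bw' /dep /= <-//]].
by exists w.
Qed.

Lemma integral_fin (f : U -> R) : (forall u, 0 <= f u) ->
  (\int[P]_w (f (H w))%:E)%E = (\sum_u law P H u * f u)%:E.
Proof.
move=> f_ge0.
have -> : (fun w => (f (H w))%:E) =
    (fun w => \sum_(u : U) ((f u)%:E * (\1_(H @^-1` [set u]) w)%:E))%E.
  apply/funext => w; rewrite (bigD1 (H w)) //= big1 => [|u uH].
    by rewrite indicE mem_set // mule1 adde0.
  rewrite indicE memNset ?mule0 // => /= Hu.
  by rewrite Hu eqxx in uH.
rewrite ge0_integral_sum //=; last first.
- by move=> u w _; rewrite mule_ge0 // lee_fin.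
- move=> u; apply: measurable_funeM; apply/measurable_EFinP.
  exact: measurable_indic.
rewrite -sumEFin; apply: eq_bigr => u _.
rewrite ge0_integralZl_EFin //; last first.
- by apply/measurable_EFinP; exact: measurable_indic.
rewrite integral_indic // setIT EFinM muleC; congr (_ * _)%E.
by rewrite /law prob_fineK.
Qed.

Lemma prob_preimage_fin (E : pred U) :
  P (H @^-1` [set u | E u]) = (\sum_(u | E u) law P H u)%:E.
Proof.
have -> : P (H @^-1` [set u | E u]) = (\int[P]_w ((E (H w))%:R : R)%:E)%E.
  rewrite -[in LHS](setIT (H @^-1` _)) -integral_indic //.
    by apply: eq_integral => w _; rewrite indicE mem_setE.
  exact: measurable_preimage_fin.
rewrite (integral_fin (f := fun u => (E u)%:R)) //; congr EFin.
rewrite [RHS]big_mkcond; apply: eq_bigr => u _.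
by case: (E u); rewrite ?mulr1 ?mulr0.
Qed.

Lemma law_comp (V : finType) (phi : U -> V) v :
  law P (fun w => phi (H w)) v = \sum_(u | phi u == v) law P H u.
Proof.
rewrite {1}/law (_ : _ @^-1` [set v] = H @^-1` [set u | phi u == v]).
  by rewrite prob_preimage_fin.
by apply/seteqP; split => w /= /eqP.
Qed.

Lemma law_sum1 : \sum_u law P H u = 1.
Proof.
have := prob_preimage_fin predT.
rewrite (_ : _ @^-1` _ = setT); last by apply/seteqP.
by rewrite probability_setT => -[].
Qed.

Lemma law_le1 u : law P H u <= 1.
Proof. by rewrite -law_sum1 (bigD1 u) //= lerDl sumr_ge0 // => v _; exact: law_ge0. Qed.

Lemma law_eq0_subset (E : set Omega) u : measurable E ->
  E `<=` H @^-1` [set u] -> law P H u = 0 -> P E = 0.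
Proof.
move=> mE EH Hu; apply/eqP; rewrite -measure_le0.
have <- : P (H @^-1` [set u]) = 0%E by rewrite -prob_fineK // -/(law P H u) Hu.
by rewrite le_measure ?inE.
Qed.

Lemma law_neq0_ex u : law P H u != 0 -> exists w, H w = u.
Proof.
move=> pu; apply/not_existsP => noex; case/eqP: pu.
rewrite /law (_ : _ @^-1` _ = set0) ?measure0 //.
by apply/seteqP; split => w //= /noex.
Qed.

End Discrete.

Lemma eq_law_determined (U V : Type) (H : Omega -> U) (G : Omega -> V) w0 :
  (forall w, H w = H w0 <-> G w = G w0) -> law P H (H w0) = law P G (G w0).
Proof.
move=> HG; rewrite /law; congr (fine (P _)).
by apply/seteqP; split => w /= /HG.
Qed.

Lemma measurable_fiberM (U V : finType) (H : Omega -> U) (G : Omega -> V) :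
  (forall u, measurable (H @^-1` [set u])) ->
  (forall v, measurable (G @^-1` [set v])) ->
  forall uv, measurable ((fun w => (H w, G w)) @^-1` [set uv]).
Proof.
move=> mH mG [u v].
rewrite (_ : _ @^-1` _ = H @^-1` [set u] `&` G @^-1` [set v]).
  exact: measurableI.
by apply/seteqP; split => w /= [-> ->].
Qed.

Section OneStep.
Variables (U T : finType) (K : T -> T -> R).
Variables (H : Omega -> U) (st next : Omega -> T).
Hypothesis mH : forall u, measurable (H @^-1` [set u]).
Hypothesis mnext : forall y, measurable (next @^-1` [set y]).
Hypothesis st_det : forall w w', H w = H w' -> st w = st w'.
Hypothesis K_ge0 : forall x y, 0 <= K x y.
Hypothesis step : forall w0 y,
  fine (P (H @^-1` [set H w0] `&` next @^-1` [set y])) =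
  law P H (H w0) * K (st w0) y.

(** The tower property given [H], without conditional expectations: [st] and [Phi] depend on the
    sample point through [H] only, and [step] gives the law of [next] given [H]. *)
Lemma integral_one_step (Phi : Omega -> T -> R) :
  (forall w y, 0 <= Phi w y) ->
  (forall w w', H w = H w' -> Phi w = Phi w') ->
  (\int[P]_w (Phi w (next w))%:E = \int[P]_w (\sum_y K (st w) y * Phi w y)%:E)%E.
Proof.
move=> Phi_ge0 Phi_det.
(* [rep] turns functions of [w] that depend on [H w] into functions on [U]; values not taken by [H]
   get 0, harmlessly since their law is 0. *)
pose rep u : option Omega :=
  if pselect (exists w, H w = u) is left e then Some (sval (cid e)) else None.
have repE w : exists2 w', rep (H w) = Some w' & H w' = H w.
  rewrite /rep; case: pselect => [e|[]]; last by exists w.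
  by exists (sval (cid e)) => //; exact: svalP (cid e).
pose f u y := if rep u is Some w then Phi w y else 0.
pose g u := if rep u is Some w then \sum_y K (st w) y * Phi w y else 0.
have fE w y : f (H w) y = Phi w y.
  by rewrite /f; case: (repE w) => w' -> /Phi_det ->.
have gE w : g (H w) = \sum_y K (st w) y * Phi w y.
  by rewrite /g; case: (repE w) => w' -> e; rewrite (Phi_det _ _ e) (st_det e).
have mHn := measurable_fiberM mH mnext.
under eq_integral do rewrite -fE.
under [RHS]eq_integral do rewrite -gE.
rewrite (integral_fin mHn (f := fun p => f p.1 p.2)); last first.
  by move=> [u y] /=; rewrite /f; case: (rep u).
rewrite (integral_fin mH (f := g)); last first.
  move=> u; rewrite /g; case: (rep u) => // w.
  by apply: sumr_ge0 => y _; rewrite mulr_ge0.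
congr EFin; rewrite sum_pairE.
apply: eq_bigr => u _.
have [u0|/law_neq0_ex [w <-]] := eqVneq (law P H u) 0.
  rewrite u0 mul0r big1 // => y _.
  rewrite [law _ _ _](_ : _ = 0) ?mul0r // /law.
  by rewrite (law_eq0_subset mH _ _ u0) // => w /= [].
rewrite gE mulr_sumr; apply: eq_bigr => y _; rewrite fE mulrA -step.
congr (fine (P _) * _).
by apply/seteqP; split => w' /= [-> ->].
Qed.

End OneStep.

End FiniteValued.

(** * Law of the iterated logarithm, upper bound *)

Section ChainProcess.
Context {d : measure_display} {Omega : measurableType d} {R : realType}.
Variables (P : probability Omega R) (T : finType) (K : T -> T -> R).
Variable Z : nat -> Omega -> T.

Fixpoint past (n : nat) (w : Omega) : seq T :=
  if n is m.+1 then Z m w :: past m w else [::].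

Lemma size_past n w : size (past n w) = n.
Proof. by elim: n => //= n ->. Qed.

Lemma path_sum_past f n w :
  path_sum f (Z n w) (past n w) = \sum_(0 <= i < n) f (Z i w) (Z i.+1 w) :> R.
Proof.
elim: n => [|n IH]; first by rewrite big_nil.
by rewrite big_nat_recr //= IH addrC.
Qed.

Hypothesis K_ge0 : forall x y, 0 <= K x y.
Hypothesis K_sum1 : forall x, \sum_y K x y = 1.
Variables (U : nat -> finType) (H : forall n, Omega -> U n).
Hypothesis mH : forall n u, measurable (H n @^-1` [set u]).
Hypothesis H_det : forall n w w', H n w = H n w' ->
  forall i, (i <= n)%N -> Z i w = Z i w'.
(** The Markov property given the history [H n], in product form so that null histories are
    included. *)
Hypothesis step : forall n w0 y,
  fine (P (H n @^-1` [set H n w0] `&` Z n.+1 @^-1` [set y])) =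
  law P (H n) (H n w0) * K (Z n w0) y.

Lemma measurable_state n x : measurable (Z n @^-1` [set x]).
Proof. by apply: (measurable_determined (@mH n) [set x]) => w w' /H_det; apply. Qed.

Lemma past_det n w w' : H n w = H n w' -> past n w = past n w'.
Proof.
move=> /H_det det; have : forall m, (m <= n)%N -> past m w = past m w'.
  by elim=> //= m IH mn; rewrite IH ?det // ltnW.
exact.
Qed.

Lemma measurable_path n (B : T -> seq T -> bool) :
  measurable [set w | B (Z n w) (past n w)].
Proof.
apply: (measurable_determined (G := fun w => B (Z n w) (past n w))
  (@mH n) [set true]) => w w' e.
by rewrite (H_det e (leqnn n)) (past_det e).
Qed.

(** Each transition is peeled off by [integral_one_step], which turns means of path functionals into
    finite sums. *)
Lemma integral_path n F : (forall x u, 0 <= F x u) ->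
  (\int[P]_w (F (Z n w) (past n w))%:E = (path_mean K (law P (Z 0)) n F)%:E)%E.
Proof.
elim: n F => [|n IH] F F_ge0 /=.
  by rewrite (integral_fin _ (@measurable_state 0) (f := fun x => F x [::])).
rewrite -IH; last by move=> x u; apply: sumr_ge0 => y _; rewrite mulr_ge0.
apply: (@integral_one_step _ _ _ P _ _ _ (H n) (Z n) (Z n.+1) _ _ _ K_ge0 _
  (fun w y => F y (Z n w :: past n w))) => //.
- exact: measurable_state.
- by move=> w w' /H_det; apply.
- by move=> w w' e; rewrite (H_det e (leqnn n)) (past_det e).
Qed.

Lemma initial_sum1 : \sum_x law P (Z 0) x = 1.
Proof. exact: law_sum1 (@measurable_state 0). Qed.

Variables (D : T -> T -> R) (c : R).
Hypothesis c_gt0 : 0 < c.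
Hypothesis D_mean0 : forall x, \sum_y K x y * D x y = 0.
Hypothesis D_le : forall x y, `|D x y| <= c.

Lemma mean_norm_path_sum n :
  (\int[P]_w (`|path_sum D (Z n.+1 w) (past n.+1 w)|)%:E
     <= ((c ^+ 2 + 1) * Num.sqrt n.+1%:R)%:E)%E.
Proof.
rewrite (integral_path _ (F := fun x u => `|path_sum D x u|)) // lee_fin.
have sq_gt0 : 0 < Num.sqrt n.+1%:R :> R by rewrite sqrtr_gt0.
apply: le_trans (path_mean_norm K_ge0 K_sum1 _ initial_sum1 D_mean0 D_le n.+1 sq_gt0) _.
  by move=> x; exact: law_ge0.
have nE : n.+1%:R = Num.sqrt n.+1%:R ^+ 2 :> R by rewrite sqr_sqrtr.
rewrite {1}nE; set s := Num.sqrt _ in sq_gt0 *.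
have -> : c ^+ 2 * s ^+ 2 / s = c ^+ 2 * s by field; rewrite gt_eqF.
have : 0 <= (c ^+ 2 + 1) * s by rewrite mulr_ge0 ?addr_ge0 ?sqr_ge0 // ltW.
lra.
Qed.

Lemma path_hits_past lam a n m w : (m <= n)%N ->
  ~~ path_hits D c lam a (Z n w) (past n w) ->
  log_weight D c lam (Z m w) (past m w) < a.
Proof.
elim: n => [|n IH] /=.
  by rewrite leqn0 => /eqP ->; rewrite orbF -ltNge.
rewrite leq_eqVlt negb_or -ltNge => /orP[/eqP -> /andP[]//|mn /andP[_]].
exact: IH.
Qed.

(* Borel-Cantelli over the dyadic blocks [2 ^ j <= n < 2 ^ j.+1]: on the [j]-th
   one, Ville's inequality is applied with the level [2 * ln j]. *)
Definition block_slope (j : nat) : R := Num.sqrt (ln j%:R / (2 ^ j)%:R) / (2 * c).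

Definition bad_block (f : T -> T -> R) (j : nat) : set Omega :=
  [set w | path_hits f c (block_slope j) (2 * ln j%:R)
             (Z (2 ^ j.+1) w) (past (2 ^ j.+1) w)].

End ChainProcess.

Section LogLaw.
Context {d : measure_display} {Omega : measurableType d} {R : realType}.
Variables (P : probability Omega R) (T : finType) (K : T -> T -> R).
Variable Z : nat -> Omega -> T.
Hypothesis K_ge0 : forall x y, 0 <= K x y.
Hypothesis K_sum1 : forall x, \sum_y K x y = 1.
Variables (U : nat -> finType) (H : forall n, Omega -> U n).
Hypothesis mH : forall n u, measurable (H n @^-1` [set u]).
Hypothesis H_det : forall n w w', H n w = H n w' ->
  forall i, (i <= n)%N -> Z i w = Z i w'.
Hypothesis step : forall n w0 y,
  fine (P (H n @^-1` [set H n w0] `&` Z n.+1 @^-1` [set y])) =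
  law P (H n) (H n w0) * K (Z n w0) y.
Variable c : R.
Hypothesis c_gt0 : 0 < c.

Let slope_ge0 j : 0 <= block_slope c j.
Proof. by rewrite divr_ge0 ?sqrtr_ge0 // mulr_ge0 // ltW. Qed.

Let ln_le_pow2 j : ln j%:R <= (2 ^ j)%:R :> R.
Proof.
have [->|j0] := posnP j; first by rewrite ln0.
rewrite (le_trans (ltW (ln_sublinear _))) ?ltr0n // ler_nat ltnW //.
exact: ltn_expl.
Qed.

(** Since [ln j <= 2 ^ j], the root in the slope is at most 1; its denominator [2 * c] turns this
    into the bound 1/2 that the exponential supermartingale requires. *)
Let slope_le j : block_slope c j * c <= 2^-1.
Proof.
rewrite /block_slope invfM mulrA divfK ?gt_eqF //.
rewrite -[leRHS]mul1r ler_wpM2r // -[leRHS]sqrtr1 ler_sqrt //.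
by rewrite ler_pdivrMr ?ltr0n ?expn_gt0 // mul1r; exact: ln_le_pow2.
Qed.

(** At level [2 * ln j], Ville's inequality gives probability at most [j ^- 2]. Indices start at 2,
    where the level becomes positive. *)
Lemma bad_block_summable (f : T -> T -> R) :
  (forall x, \sum_y K x y * f x y = 0) -> (forall x y, `|f x y| <= c) ->
  (\sum_(j <oo) P (bad_block Z c f j.+2) < +oo)%E.
Proof.
(* [b j] dominates [(j + 2) ^- 2] and its sum telescopes. *)
move=> f0 fc; pose b j : \bar R := (j.+1%:R^-1 - j.+2%:R^-1)%:E.
have Pb j : (P (bad_block Z c f j.+2) <= b j)%E.
  have -> : P (bad_block Z c f j.+2) =
    (\int[P]_w ((path_hits f c (block_slope c j.+2) (2 * ln j.+2%:R)
             (Z (2 ^ j.+3) w) (past Z (2 ^ j.+3) w))%:R : R)%:E)%E.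
    rewrite -[in LHS](setIT (bad_block _ _ _ _)) -integral_indic //.
      by apply: eq_integral => w _; rewrite indicE mem_setE.
    exact: (measurable_path mH H_det).
  rewrite (integral_path K_ge0 mH H_det step _ (F := fun x u =>
    (path_hits f c (block_slope c j.+2) (2 * ln j.+2%:R) x u)%:R)) // lee_fin.
  have level_gt0 : 0 < 2 * ln j.+2%:R :> R by rewrite mulr_gt0 // ln_gt0 // ltr1n.
  apply: le_trans (path_hits_mean_le K_ge0 K_sum1 (law_ge0 P (Z 0))
    (initial_sum1 P mH H_det) f0 fc (slope_ge0 _) (slope_le _) _ level_gt0) _.
  rewrite expRN mulr_natl mulr2n expRD lnK ?posrE //.
  rewrite -subr_ge0.
  have -> : (j.+1%:R^-1 - j.+2%:R^-1 - (j.+2%:R * j.+2%:R)^-1 : R) =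
      (j.+1%:R * j.+2%:R * j.+2%:R)^-1.
    rewrite -[j.+2%:R]natr1 -natr1; field.
    by rewrite !natr1 !pnatr_eq0.
  by rewrite invr_ge0 !mulr_ge0.
apply: (@le_lt_trans _ _ 1%E); last by rewrite ltry.
apply: lime_le; first by apply: is_cvg_nneseries => n _ _; exact: measure_ge0.
apply: nearW => n; apply: (@le_trans _ _ (\sum_(0 <= j < n) b j)%E).
  by apply: lee_sum => j _; exact: Pb.
rewrite sumEFin lee_fin.
have -> : \sum_(0 <= j < n) (j.+1%:R^-1 - j.+2%:R^-1) = 1 - n.+1%:R^-1 :> R.
  elim: n => [|n IH]; first by rewrite big_nil invr1 subrr.
  by rewrite big_nat_recr //= IH addrA subrK.
by rewrite lerBlDr lerDl invr_ge0.
Qed.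

Lemma path_sum_log_log_upper (f : T -> T -> R) :
  (forall x, \sum_y K x y * f x y = 0) -> (forall x y, `|f x y| <= c) ->
  {ae P, forall w, exists N, forall n, (N <= n)%N ->
    path_sum f (Z n w) (past Z n w) <= 12 * c * Num.sqrt (n%:R * ln (ln n%:R))}.
Proof.
move=> f0 fc.
have mbad j : measurable (bad_block Z c f j) by exact: (measurable_path mH H_det).
have null := lim_sup_set_cvg0 (fun j => mbad j.+2) (bad_block_summable f0 fc).
exists (lim_sup_set (fun j => bad_block Z c f j.+2)); split => //.
  by apply: bigcap_measurable => // j _; apply: bigcup_measurable.
move=> w; apply: contra_notP => /= notlim.
have [J good] : exists J, forall j, (J <= j)%N -> ~ bad_block Z c f j w.
  move: notlim => /existsNP[J] /not_implyP[_ nJ].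
  exists J.+2 => -[//|[//|j]]; rewrite !ltnS => Jj bad.
  by apply: nJ; exists j.
(* From [J] on no block is bad; [4 <= j] is what [j <= (j / 2) ^+ 2] requires below. *)
exists (2 ^ maxn J 4)%N => n Nn.
have n_gt0 : (0 < n)%N by rewrite (leq_trans _ Nn) // expn_gt0.
pose j := trunc_log 2 n.
have [jn nj] : (2 ^ j <= n)%N /\ (n < 2 ^ j.+1)%N.
  by have /andP[] := trunc_log_bounds (isT : (1 < 2)%N) n_gt0.
have : (maxn J 4 <= j)%N by rewrite trunc_log_max.
rewrite geq_max => /andP[Jj j4].
have /negP := good j Jj => /(path_hits_past (ltnW nj)).
set M := path_sum _ _ _; rewrite /log_weight size_past -/M.
pose L : R := ln j%:R; pose r : R := Num.sqrt (L / (2 ^ j)%:R).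
have L_gt0 : 0 < L by rewrite ln_gt0 // ltr1n (leq_trans _ j4).
have p_gt0 : 0 < (2 ^ j)%:R :> R by rewrite ltr0n expn_gt0.
have r_gt0 : 0 < r by rewrite sqrtr_gt0 divr_gt0.
have r2 : r ^+ 2 * (2 ^ j)%:R = L.
  by rewrite sqr_sqrtr ?divfK ?gt_eqF // divr_ge0 // ltW.
have -> : block_slope c j * c = r / 2.
  by rewrite /block_slope -/r; field; rewrite gt_eqF.
rewrite /block_slope -/L -/r => weight.
have n_le : n%:R <= 2 * (2 ^ j)%:R :> R by rewrite -natrM ler_nat -expnS ltnW.
(* With [lam = r / (2 * c)] and [n <= 2 * 2 ^ j], the compensator [2 * (lam * c) ^+ 2 * n] is at
   most [L]; adding the level [2 * L] gives [lam * M <= 3 * L]. *)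
have M_le : M * r <= 6 * c * L.
  have : r / (2 * c) * M <= 3 * L.
    have : 2 * (r / 2) ^+ 2 * n%:R <= L.
      apply: (@le_trans _ _ (2 * (r / 2) ^+ 2 * (2 * (2 ^ j)%:R))).
        by rewrite ler_wpM2l // mulr_ge0 // sqr_ge0.
      by rewrite -r2 le_eqVlt; apply/orP; left; apply/eqP; field.
    by move: weight => /ltW; rewrite lerBlDr -/L; lra.
  have -> : M * r = r / (2 * c) * M * (2 * c) by field; rewrite gt_eqF.
  move=> weight'; have := ler_wpM2r (ltW (mulr_gt0 (ltr0Sn R 1) c_gt0)) weight'; lra.
(* [ln n >= j * ln 2 >= j / 2], and [ln j <= 2 * ln (j / 2)] once [j >= 4]; [ln 2 >= 1/2] is the
   quadratic bound on the exponential at 1/2. *)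
have lnln : L <= 2 * ln (ln n%:R).
  have ln2 : 2^-1 <= ln 2 :> R.
    rewrite -[leLHS]expRK ler_ln ?posrE ?expR_gt0 //.
    by apply: le_trans (expR_le_quadratic (lexx _)) _; lra.
  have lnn : j%:R / 2 <= ln n%:R :> R.
    apply: (@le_trans _ _ (ln (2 ^ j)%:R)); last first.
      by rewrite ler_ln ?posrE ?ltr0n ?expn_gt0 // ler_nat.
    by rewrite natrX lnXn // -[leRHS]mulr_natl ler_wpM2l.
  have j_le : j%:R <= (j%:R / 2) ^+ 2 :> R.
    have : 4 <= j%:R :> R by rewrite ler_nat.
    nra.
  have j2_gt0 : 0 < j%:R / 2 :> R by rewrite divr_gt0 // ltr0n (leq_trans _ j4).
  rewrite /L; apply: (@le_trans _ _ (ln ((j%:R / 2) ^+ 2))).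
    by rewrite ler_ln ?posrE ?exprn_gt0 // ltr0n (leq_trans _ j4).
  rewrite lnXn // -[leLHS]mulr_natl ler_wpM2l // ler_ln ?posrE //.
  exact: lt_le_trans lnn.
have lnln_gt0 : 0 < ln (ln n%:R) :> R by lra.
(* After multiplying by [r] and squaring, what remains is [L ^+ 2 / 4 <= n * ln (ln n) * r ^+ 2],
   from [L <= n * r ^+ 2] and [L <= 2 * ln (ln n)]. *)
rewrite -(ler_pM2r r_gt0) (le_trans M_le) //.
have -> : 6 * c * L = 12 * c * (L / 2) by field.
rewrite -[leRHS]mulrA ler_pM2l ?mulr_gt0 //.
have L_ge0 := ltW L_gt0.
rewrite -[leLHS](ger0_norm (_ : 0 <= L / 2)) ?divr_ge0 // -sqrtr_sqr.
rewrite -[r in leRHS](ger0_norm (ltW r_gt0)) -sqrtr_sqr -sqrtrM; last first.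
  by rewrite mulr_ge0 // ltW.
rewrite ler_sqrt; last by rewrite mulr_ge0 ?sqr_ge0 // mulr_ge0 // ltW.
rewrite mulrAC expr_div_n [L ^+ 2]expr2.
have : (2 ^ j)%:R * r ^+ 2 <= n%:R * r ^+ 2.
  by rewrite ler_wpM2r ?sqr_ge0 // ler_nat.
rewrite [_ * r ^+ 2]mulrC r2 => nL.
apply: (@le_trans _ _ (L * ln (ln n%:R))).
  by rewrite -mulrA ler_wpM2l //; lra.
by rewrite ler_wpM2r // ltW.
Qed.

Lemma path_sum_log_log (f : T -> T -> R) :
  (forall x, \sum_y K x y * f x y = 0) -> (forall x y, `|f x y| <= c) ->
  {ae P, forall w, exists N, forall n, (N <= n)%N ->
    `|path_sum f (Z n w) (past Z n w)| <= 12 * c * Num.sqrt (n%:R * ln (ln n%:R))}.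
Proof.
move=> f0 fc.
have pathN x u : path_sum (fun x y => - f x y) x u = - path_sum f x u.
  elim: u x => [|z u IH] x /=; first by rewrite oppr0.
  by rewrite IH opprD.
have Nf0 x : \sum_y K x y * - f x y = 0.
  by under eq_bigr do rewrite mulrN; rewrite sumrN f0 oppr0.
have Nfc x y : `|- f x y| <= c by rewrite normrN.
apply: filterS2 (path_sum_log_log_upper f0 fc) (path_sum_log_log_upper Nf0 Nfc).
move=> w [N1 H1] [N2 H2]; exists (maxn N1 N2) => n.
rewrite geq_max => /andP[/H1 le1 /H2]; rewrite pathN => le2.
by rewrite ler_norml lerNl le1 le2.
Qed.

End LogLaw.

(** * Rates for ergodic averages *)

Section ErgodicAverage.
Context {d : measure_display} {Omega : measurableType d} {R : realType}.
Variables (P : probability Omega R) (T : finType) (K : T -> T -> R).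
Variable Z : nat -> Omega -> T.
Hypothesis K_ge0 : forall x y, 0 <= K x y.
Hypothesis K_sum1 : forall x, \sum_y K x y = 1.
Variables (U : nat -> finType) (H : forall n, Omega -> U n).
Hypothesis mH : forall n u, measurable (H n @^-1` [set u]).
Hypothesis H_det : forall n w w', H n w = H n w' ->
  forall i, (i <= n)%N -> Z i w = Z i w'.
Hypothesis step : forall n w0 y,
  fine (P (H n @^-1` [set H n w0] `&` Z n.+1 @^-1` [set y])) =
  law P (H n) (H n w0) * K (Z n w0) y.
Variables (m : nat) (w0 : T) (eps : R).
Hypothesis eps_gt0 : 0 < eps.
Hypothesis doeblin : forall x, eps <= kernel_iter K m x w0.
Variable pi0 : T -> R.
Hypothesis pi_ge0 : forall x, 0 <= pi0 x.
Hypothesis pi_sum1 : \sum_x pi0 x = 1.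
Hypothesis pi_inv : forall y, \sum_x pi0 x * K x y = pi0 y.
Variable f : T -> T -> R.

Let mu := \sum_x \sum_y pi0 x * K x y * f x y.

Let avg n w : R := n%:R^-1 * \sum_(0 <= i < n) f (Z i w) (Z i.+1 w).

Lemma martingale_decomposition : exists D c,
  [/\ 0 < c, (forall x, \sum_y K x y * D x y = 0), (forall x y, `|D x y| <= c) &
    forall n w, (0 < n)%N ->
      `|avg n w - mu| <= n%:R^-1 * `|path_sum D (Z n w) (past Z n w)| + n%:R^-1 * c].
Proof.
pose h x := \sum_y K x y * f x y - mu.
have pih : \sum_x pi0 x * h x = 0.
  under eq_bigr do rewrite mulrBr mulr_sumr.
  rewrite sumrB -mulr_suml pi_sum1 mul1r; apply/eqP; rewrite subr_eq0.
  by apply/eqP; apply: eq_bigr => x _; apply: eq_bigr => y _; rewrite mulrA.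
have [g gE] := poisson_equation K_ge0 K_sum1 eps_gt0 doeblin pi_sum1 pi_inv pih.
(* The conditional mean of [D] at [x] is [h x + kernel_op K g x - g x], which Poisson's equation
   makes 0. The constant [c] bounds both the increments and the boundary term [g (Z 0) - g (Z n)];
   its summand 1 makes it positive. *)
pose D x y := f x y - mu + (g y - g x).
pose c := 1 + \sum_x \sum_y `|D x y| + \sum_x \sum_y `|g x - g y|.
have le_sum2 (F : T -> T -> R) x y : `|F x y| <= \sum_x \sum_y `|F x y|.
  rewrite (bigD1 x) //= (bigD1 y) //= -addrA lerDl.
  by rewrite addr_ge0 ?sumr_ge0 // => *; exact: sumr_ge0.
have sum2_ge0 (F : T -> T -> R) : 0 <= \sum_x \sum_y `|F x y|.
  by apply: sumr_ge0 => *; exact: sumr_ge0.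
exists D, c; split.
- by rewrite /c -addrA ltr_pwDl // addr_ge0.
- move=> x; rewrite /D; under eq_bigr do rewrite mulrDr !mulrBr.
  rewrite big_split !sumrB -!mulr_suml K_sum1 !mul1r.
  by rewrite -/(kernel_op K g x) -/(h x) -gE /= subrKA subrr.
- by move=> x y; rewrite /c addrAC (le_trans (le_sum2 D x y)) // lerDr addr_ge0.
- move=> n w n_gt0; have nR : n%:R != 0 :> R by rewrite pnatr_eq0 -lt0n.
  have telescope : \sum_(0 <= i < n) f (Z i w) (Z i.+1 w) - n%:R * mu =
      path_sum D (Z n w) (past Z n w) + (g (Z 0 w) - g (Z n w)).
    rewrite path_sum_past /D big_split /= telescope_sumr // sumrB.
    by rewrite big_const_nat iter_addr_0 subn0 mulr_natl; ring.
  have -> : avg n w - mu = n%:R^-1 * path_sum D (Z n w) (past Z n w)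
      + n%:R^-1 * (g (Z 0 w) - g (Z n w)).
    by rewrite -mulrDr -telescope mulrBr mulKf.
  rewrite (le_trans (ler_normD _ _)) // !normrM ger0_norm ?invr_ge0 //.
  rewrite lerD2l ler_wpM2l ?invr_ge0 //.
  rewrite (le_trans (le_sum2 (fun x y => g x - g y) _ _)) // /c lerDr.
  by rewrite addr_ge0.
Qed.

Lemma ergodic_average_as : exists C : R, {ae P, forall w, exists N, forall n,
  (N <= n)%N -> `|avg n w - mu| <= C * Num.sqrt (ln (ln n%:R) / n%:R)}.
Proof.
have [D [c [c_gt0 D0 Dc avgE]]] := martingale_decomposition.
(* 12 from the martingale and 1 from the bounded term, which is absorbed once [n * ln (ln n) >= 1];
   beyond [expR (expR 1)] this holds. *)
exists (13 * c).
apply: filterS (path_sum_log_log K_ge0 K_sum1 mH H_det step c_gt0 D0 Dc).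
move=> w [N bound].
have [n1 n1P] : exists n1 : nat, expR (expR 1) <= n1%:R :> R.
  have := archi_boundP (expR_ge0 (expR 1 : R)) => /ltW.
  by exists (Num.bound (expR (expR 1 : R))).
exists (maxn N (maxn 1 n1)) => n; rewrite !geq_max => /andP[Nn /andP[n_gt0 n1n]].
apply: le_trans (avgE n w n_gt0) _.
have nR : 0 < n%:R :> R by rewrite ltr0n.
have ln_ge : expR 1 <= ln n%:R :> R.
  rewrite -[leLHS]expRK ler_ln ?posrE ?expR_gt0 //.
  by rewrite (le_trans n1P) // ler_nat.
have lnln_ge : 1 <= ln (ln n%:R) :> R.
  by rewrite -[leLHS]expRK ler_ln ?posrE ?expR_gt0 // (lt_le_trans (expR_gt0 1) ln_ge).
set L := ln (ln _) in lnln_ge *.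
have sq : Num.sqrt (n%:R * L) = n%:R * Num.sqrt (L / n%:R).
  rewrite -[X in _ = X * _](ger0_norm (ltW nR)) -sqrtr_sqr -sqrtrM ?sqr_ge0 //.
  by congr Num.sqrt; field; rewrite gt_eqF.
have sq_ge : 1 <= Num.sqrt (n%:R * L).
  have nL : 1 <= n%:R * L by rewrite -[leLHS]mulr1 ler_pM // ler1n.
  by rewrite -[leLHS]sqrtr1 ler_sqrt // (le_trans ler01).
have := bound n Nn; rewrite -/L; set M := `|_| => M_le.
have -> : 13 * c * Num.sqrt (L / n%:R) = n%:R^-1 * (13 * c * Num.sqrt (n%:R * L)).
  by rewrite sq; field; rewrite gt_eqF.
rewrite -mulrDr ler_wpM2l ?invr_ge0 ?(ltW nR) //.
have : c <= c * Num.sqrt (n%:R * L) by rewrite ler_peMr // ltW.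
lra.
Qed.

Lemma ergodic_average_L1 : exists2 C : R, 0 <= C & forall n,
  (\int[P]_w (`|avg n.+1 w - mu|)%:E <= (C / Num.sqrt n.+1%:R)%:E)%E.
Proof.
have [D [c [c_gt0 D0 Dc avgE]]] := martingale_decomposition.
have mean := mean_norm_path_sum K_ge0 K_sum1 mH H_det step D0 Dc.
exists (c ^+ 2 + 1 + c) => [|n].
  by rewrite addr_ge0 ?addr_ge0 ?sqr_ge0 // ltW.
have mfun (F : T -> seq T -> R) :
    measurable_fun setT (fun w => (F (Z n.+1 w) (past Z n.+1 w))%:E).
  apply/measurable_EFinP => _ B mB; rewrite setTI.
  apply: (measurable_determined (@mH n.+1)) => w w' e.
  by rewrite (H_det e (leqnn _)) (past_det H_det e).
have mavg : measurable_fun setT (fun w => (`|avg n.+1 w - mu|)%:E).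
  apply/measurable_EFinP => _ B mB; rewrite setTI.
  apply: (measurable_determined (@mH n.+1)) => w w' e.
  rewrite /avg !big_nat; congr `|_ * _ - _|; apply: eq_bigr => i /= i_lt.
  by rewrite !(H_det e) // ltnW.
pose ni : R := n.+1%:R^-1.
have ni_ge0 : 0 <= ni by rewrite invr_ge0.
apply: (@le_trans _ _ (\int[P]_w ((ni%:E
   * (`|path_sum D (Z n.+1 w) (past Z n.+1 w)|)%:E + (ni * c)%:E)))%E).
  apply: ge0_le_integral => //.
  - by apply: emeasurable_funD => //; apply: measurable_funeM; exact: (mfun (fun x u => `|path_sum D x u|)).
  - by move=> w _; rewrite -EFinM -EFinD lee_fin; exact: avgE.
rewrite ge0_integralD //; last 3 first.
- by move=> w _; rewrite mule_ge0 ?lee_fin.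
- by apply: measurable_funeM; exact: (mfun (fun x u => `|path_sum D x u|)).
- by move=> w _; rewrite lee_fin mulr_ge0 // ltW.
rewrite ge0_integralZl_EFin //; last exact: (mfun (fun x u => `|path_sum D x u|)).
rewrite integral_cst // [X in (_ + _ * X)%E](_ : _ = 1%E) ?mule1; last exact: probability_setT.
apply: (@le_trans _ _ ((ni * ((c ^+ 2 + 1) * Num.sqrt n.+1%:R) + ni * c)%:E)).
  rewrite EFinD leeD2r // EFinM lee_wpmul2l ?lee_fin //; exact: mean.
rewrite lee_fin /ni.
have sq_gt0 : 0 < Num.sqrt n.+1%:R :> R by rewrite sqrtr_gt0.
have sq_ge1 : 1 <= Num.sqrt n.+1%:R :> R.
  by rewrite -[leLHS]sqrtr1 ler_sqrt // ler1n.
set s := Num.sqrt _ in sq_gt0 sq_ge1 *.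
have -> : n.+1%:R = s * s by rewrite -expr2 sqr_sqrtr.
have -> : (s * s)^-1 * ((c ^+ 2 + 1) * s) + (s * s)^-1 * c =
    (c ^+ 2 + 1 + c / s) / s by field; rewrite gt_eqF.
rewrite ler_wpM2r ?invr_ge0 ?(ltW sq_gt0) // lerD2l ler_pdivrMr //.
by rewrite ler_peMr // ltW.
Qed.

End ErgodicAverage.

Lemma rcons_tuple_inj (C : Type) n (u u' : n.-tuple C) c c' :
  [tuple of rcons u c] = [tuple of rcons u' c'] -> u = u' /\ c = c'.
Proof.
by move=> /(congr1 val) /= /rcons_inj[e ->]; split=> //; exact: val_inj.
Qed.

(** * Blocks of a Markov chain of memory [k] *)

Section Windows.
Context {Omega C : Type}.
Variable V : int -> Omega -> C.

Lemma val_window s l w :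
  val (window V s l w) = [seq V (s + i%:Z) w | i <- iota 0 l].
Proof. by rewrite /= -val_enum_ord -map_comp. Qed.

Lemma window_eqP s l w w' : window V s l w = window V s l w' <->
  (forall i, (i < l)%N -> V (s + i%:Z) w = V (s + i%:Z) w').
Proof.
split=> [e i il|e]; last first.
  by apply: eq_from_tnth => i; rewrite !tnth_mktuple e.
by have := congr1 (fun t => tnth t (Ordinal il)) e; rewrite !tnth_mktuple.
Qed.

Lemma window_sub (s : int) l (s' : int) l' w w' : s <= s' -> s' + l'%:Z <= s + l%:Z ->
  window V s l w = window V s l w' -> window V s' l' w = window V s' l' w'.
Proof.
move=> ss' ll' /window_eqP e; apply/window_eqP => i il'.
have -> : s' + i%:Z = s + (absz (s' + i%:Z - s)%R)%:Z by lia.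
by apply: e; lia.
Qed.

Lemma window_last (s : int) l w w' (t : int) : s <= t -> t < s + l%:Z ->
  window V s l w = window V s l w' -> V t w = V t w'.
Proof.
move=> st tl /window_eqP e.
have -> : t = s + (absz (t - s)%R)%:Z by lia.
by apply: e; lia.
Qed.

Lemma window_rcons s l w :
  window V s l.+1 w = [tuple of rcons (window V s l w) (V (s + l%:Z) w)].
Proof.
apply: val_inj; rewrite [LHS]val_window.
have -> : iota 0 l.+1 = iota 0 l ++ [:: l] by rewrite -addn1 iotaD.
by rewrite map_cat -val_window cats1.
Qed.

Lemma window_cat s l k w :
  [tuple of window V s l w ++ window V (s + l%:Z) k w] = window V s (l + k) w.
Proof.
apply: val_inj; rewrite [RHS]val_window iotaD map_cat -val_window.
transitivity (val (window V s l w) ++ val (window V (s + l%:Z) k w)) => //.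
congr (_ ++ _); rewrite val_window -[(0 + l)%N]addnC iotaDl -map_comp.
by apply: eq_map => i /=; rewrite PoszD addrA.
Qed.

Lemma window_shift s k w :
  window V (s + 1) k w = [tuple of behead (rcons (window V s k w) (V (s + k%:Z) w))].
Proof.
apply: val_inj; rewrite [LHS]val_window /=.
have -> : rcons (window V s k w) (V (s + k%:Z) w) = val (window V s k.+1 w).
  by rewrite window_rcons.
rewrite val_window /= (iotaDl 1 0) -map_comp.
by apply: eq_map => i /=; rewrite PoszD addrA.
Qed.

End Windows.

Lemma window_fst (Omega A B : Type) (X : int -> Omega -> A) (Y : int -> Omega -> B)
  s l w : [tuple of map fst (window (pair_process X Y) s l w)] = window X s l w.
Proof. by apply: eq_from_tnth => i; rewrite tnth_map !tnth_mktuple. Qed.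

Lemma window_snd (Omega A B : Type) (X : int -> Omega -> A) (Y : int -> Omega -> B)
  s l w : [tuple of map snd (window (pair_process X Y) s l w)] = window Y s l w.
Proof. by apply: eq_from_tnth => i; rewrite tnth_map !tnth_mktuple. Qed.

Lemma window_pairP (Omega A B : Type) (X : int -> Omega -> A) (Y : int -> Omega -> B)
    s l w w' :
  window (pair_process X Y) s l w = window (pair_process X Y) s l w' <->
  window X s l w = window X s l w' /\ window Y s l w = window Y s l w'.
Proof.
split=> [e|[eX eY]]; first by rewrite -!(window_fst X Y) -!(window_snd X Y) e.
apply/window_eqP => i il; rewrite /pair_process.
by move/window_eqP/(_ i il): eX => ->; move/window_eqP/(_ i il): eY => ->.
Qed.

(** * Conditional laws given a determined history *)

Section WindowProbability.
Context {d : measure_display} {Omega : measurableType d} {R : realType}.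
Variable P : probability Omega R.

Lemma measurable_window (C : finType) (V : int -> Omega -> C) (s : int) :
  (forall n, s <= n -> forall c, measurable (V n @^-1` [set c])) ->
  forall s', s <= s' -> forall l v, measurable (window V s' l @^-1` [set v]).
Proof.
move=> mV s' ss' l v.
rewrite (_ : _ @^-1` _ =
    \bigcap_(i in [set: 'I_l]) (V (s' + i%:Z) @^-1` [set tnth v i])).
  apply: fin_bigcap_measurable; first exact: finite_finset.
  by move=> i _; apply: mV; lia.
apply/seteqP; split => w /= e.
  by move=> i _ /=; rewrite -e tnth_mktuple.
by apply: eq_from_tnth => i; rewrite tnth_mktuple; exact: (e i I).
Qed.

Section Coarsen.
Variables (U U' T : finType) (H : Omega -> U) (G : Omega -> U') (next : Omega -> T).
Hypothesis mH : forall u, measurable (H @^-1` [set u]).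
Hypothesis mnext : forall y, measurable (next @^-1` [set y]).

Lemma prob_determined_next (B : set Omega) (E : pred T) :
  (forall w w', H w = H w' -> B w -> B w') ->
  fine (P (B `&` next @^-1` [set y | E y])) =
  \sum_(u | `[< exists2 w, H w = u & B w >])
    \sum_(y | E y) fine (P (H @^-1` [set u] `&` next @^-1` [set y])).
Proof.
move=> det.
have -> : B `&` next @^-1` [set y | E y] = (fun w => (H w, next w)) @^-1`
    [set p | `[< exists2 w, H w = p.1 & B w >] && E p.2].
  apply/seteqP; split => w /= => [[Bw Ew]|/andP[/asboolP[w' e Bw'] ->]].
    by apply/andP; split => //; apply/asboolP; exists w.
  by split => //; exact: det e Bw'.
rewrite prob_preimage_fin; last exact: measurable_fiberM.
rewrite /= (eq_bigr (fun p => law P (fun w => (H w, next w)) (p.1, p.2))); last by case.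
rewrite -(pair_big (fun u => `[< exists2 w, H w = u & B w >]) E
  (fun u y => law P (fun w => (H w, next w)) (u, y))) /=.
apply: eq_bigr => u _; apply: eq_bigr => y _; congr (fine (P _)).
by apply/seteqP; split => w /= [-> ->].
Qed.

Lemma prob_determined (B : set Omega) :
  (forall w w', H w = H w' -> B w -> B w') ->
  fine (P B) = \sum_(u | `[< exists2 w, H w = u & B w >]) law P H u.
Proof.
move=> det.
have BE : B = H @^-1` [set u | `[< exists2 w, H w = u & B w >]].
  apply/seteqP; split => w /= => [Bw|/asboolP[w' e Bw']]; last exact: det e Bw'.
  by apply/asboolP; exists w.
by rewrite {1}BE prob_preimage_fin.
Qed.

(** If the conditional probability [kappa] of an event given [H] depends only on the coarser [G],
    averaging it over the fibres of [H] inside a fibre of [G] leaves it unchanged. *)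
Lemma next_coarsen (kappa : Omega -> R) (E : pred T) :
  (forall w w', H w = H w' -> G w = G w') ->
  (forall w w', G w = G w' -> kappa w = kappa w') ->
  (forall w0, fine (P (H @^-1` [set H w0] `&` next @^-1` [set y | E y])) =
    law P H (H w0) * kappa w0) ->
  forall w0, fine (P (G @^-1` [set G w0] `&` next @^-1` [set y | E y])) =
    law P G (G w0) * kappa w0.
Proof.
move=> HG Gk stepH w0.
have det w w' : H w = H w' -> (G @^-1` [set G w0]) w -> (G @^-1` [set G w0]) w'.
  by move=> /HG /= ->.
rewrite prob_determined_next // /law (prob_determined det) mulr_suml.
apply: eq_bigr => u /asboolP[w <- /= Gw].
rewrite -(Gk _ _ Gw) -stepH.
rewrite (@prob_determined_next (H @^-1` [set H w])); last by move=> ? ? /= ->.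
rewrite (big_pred1 (H w)) // => u' /=.
by apply/asboolP/eqP => [[w' <- /= ->]//|->]; exists w.
Qed.

End Coarsen.

Section MarkovStep.
Variables (C : finType) (k : nat) (q : nat -> k.-tuple C -> C -> R).
Variables (V : int -> Omega -> C) (s : int).
Hypothesis mV : forall n, s <= n -> forall c, measurable (V n @^-1` [set c]).
Hypothesis markov : markov_from P q V s.

(** The definition speaks of ratios at histories of positive probability; the product form covers
    null histories as well, both sides being 0 there. *)
Lemma markov_step l w0 c :
  fine (P (window V s (l + k) @^-1` [set window V s (l + k) w0]
           `&` V (s + (l + k)%N%:Z) @^-1` [set c])) =
  law P (window V s (l + k)) (window V s (l + k) w0)
    * q l (window V (s + l%:Z) k w0) c.
Proof.
have mW := measurable_window mV (lexx s).
have -> : window V s (l + k) @^-1` [set window V s (l + k) w0]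
      `&` V (s + (l + k)%N%:Z) @^-1` [set c] =
    window V s (l + k).+1 @^-1` [set [tuple of rcons (window V s (l + k) w0) c]].
  apply/seteqP; split => w /=.
    by move=> [e Vc]; rewrite window_rcons e Vc.
  by rewrite window_rcons => e; case: (rcons_tuple_inj e).
have [law0|law_neq0] := eqVneq (law P (window V s (l + k)) (window V s (l + k) w0)) 0.
  rewrite law0 mul0r; apply: (congr1 fine (law_eq0_subset (mW _) (mW _ _) _ law0)) => w /=.
  by rewrite window_rcons => e; case: (rcons_tuple_inj e).
have := @markov l (window V s l w0) (window V (s + l%:Z) k w0) c.
rewrite !window_cat => /(_ law_neq0) <-.
rewrite mulrC divfK // /law; congr (fine (P (_ @^-1` [set _]))).
apply: val_inj; transitivity (rcons
  (val [tuple of window V s l w0 ++ window V (s + l%:Z) k w0]) c) => //.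
by rewrite window_cat.
Qed.

(** [G] lies between the whole past, which determines it, and the last [k] values, which it
    determines; conditioning on it gives the same transition probability. *)
Lemma markov_step_determined (U : finType) (G : Omega -> U) l c w0 :
  (forall w w', window V s (l + k) w = window V s (l + k) w' -> G w = G w') ->
  (forall w w', G w = G w' ->
     window V (s + l%:Z) k w = window V (s + l%:Z) k w') ->
  fine (P (G @^-1` [set G w0] `&` V (s + (l + k)%N%:Z) @^-1` [set c])) =
  law P G (G w0) * q l (window V (s + l%:Z) k w0) c.
Proof.
move=> det detK.
have mW v : measurable (window V s (l + k) @^-1` [set v]).
  exact: (measurable_window mV).
have mN y : measurable (V (s + (l + k)%N%:Z) @^-1` [set y]) by apply: mV; lia.
have := @next_coarsen _ _ _ (window V s (l + k)) G _ mW mN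
  (fun w => q l (window V (s + l%:Z) k w) c) (pred1 c) det.
have -> : [set y | pred1 c y] = [set c] by apply/seteqP; split => y /= /eqP.
apply; first by move=> w w' /detK ->.
by move=> w; exact: markov_step.
Qed.

End MarkovStep.

Lemma block_step (C : finType) (k : nat) (Q : k.-tuple C -> C -> R)
    (V : int -> Omega -> C) (s : int) (U : finType) (G : Omega -> U) l y w0 :
  (forall n, s <= n -> forall c, measurable (V n @^-1` [set c])) ->
  markov_from P (fun _ => Q) V s ->
  (forall w w', window V s (l + k) w = window V s (l + k) w' -> G w = G w') ->
  (forall w w', G w = G w' ->
     window V (s + l%:Z) k w = window V (s + l%:Z) k w') ->
  fine (P (G @^-1` [set G w0] `&` window V (s + l%:Z + 1) k @^-1` [set y])) =
  law P G (G w0) * block_kernel Q (window V (s + l%:Z) k w0) y.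
Proof.
move=> mV markov det detK.
have mW v : measurable (window V s (l + k) @^-1` [set v]).
  exact: (measurable_window mV).
have mG u : measurable (G @^-1` [set u]) by exact: (measurable_determined mW).
have mN c : measurable (V (s + (l + k)%N%:Z) @^-1` [set c]) by apply: mV; lia.
rewrite /block_kernel mulr_sumr.
under eq_bigr do rewrite -(markov_step_determined mV markov _ _ det detK).
set x := window V (s + l%:Z) k w0.
have -> : G @^-1` [set G w0] `&` window V (s + l%:Z + 1) k @^-1` [set y] =
    G @^-1` [set G w0] `&` V (s + (l + k)%N%:Z) @^-1`
      [set c | y == [tuple of behead (rcons x c)]].
  apply/seteqP; split => w /= [Gw]; rewrite window_shift (detK _ _ Gw) -/x;
    rewrite PoszD addrA.
    by move=> <-; split.
  by move=> /eqP ->; split.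
rewrite (@prob_determined_next _ _ G _ mG mN); last by move=> ? ? /= ->.
rewrite (big_pred1 (G w0)) // => u' /=.
by apply/asboolP/eqP => [[w' <- /= ->]//|->]; exists w0.
Qed.

End WindowProbability.

(** * Doeblin's condition from irreducibility and aperiodicity *)

(* Take [b] and [b + d] in the semigroup with [d > 0] minimal: then [d] divides
   every element, so [d = 1], and [b], [b + 1] generate all large integers. *)
Lemma additive_gcd1_cofinite (S : nat -> Prop) :
  S 0%N -> (forall a b, S a -> S b -> S (a + b)%N) ->
  (forall m, (forall n, (0 < n)%N -> S n -> (m %| n)%N) -> m = 1%N) ->
  exists N, forall n, (N <= n)%N -> S n.
Proof.
move=> S0 SD gcd1.
have SM q a : S a -> S (q * a)%N.
  by move=> Sa; elim: q => // q IH; rewrite mulSn; exact: SD.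
pose gap d := `[< (0 < d)%N /\ exists2 b, S b & S (b + d)%N >].
have ex_gap : exists d, gap d.
  apply: contrapT => nogap; suff : 2%N = 1%N by [].
  apply: gcd1 => n n0 Sn; case: nogap; exists n; apply/asboolP; split => //.
  by exists 0%N.
case: (ex_minnP ex_gap) => d /asboolP[d0 [b Sb Sbd]] dmin.
have d1 : d = 1%N.
  apply: gcd1 => t _ St; rewrite /dvdn; apply/eqP.
  apply: contrapT => /eqP; rewrite -lt0n => r0.
  have : gap (t %% d)%N.
    apply/asboolP; split => //; exists ((t %/ d) * (b + d))%N; first exact: SM.
    have -> : ((t %/ d) * (b + d) + t %% d = t + (t %/ d) * b)%N.
      by have := divn_eq t d; rewrite mulnDr; lia.
    by apply: SD => //; exact: SM.
  by move=> /dmin; rewrite leqNgt ltn_mod d0.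
rewrite d1 addn1 in Sbd; exists (b * b)%N => n bn.
have [b0|b0] := posnP b; first by rewrite b0 in Sbd; rewrite -(muln1 n); exact: SM.
have r_lt := ltn_pmod n b0.
have q_ge : (b <= n %/ b)%N by rewrite leq_divRL.
rewrite (_ : n = (n %/ b - n %% b) * b + (n %% b) * b.+1)%N.
  by apply: SD; exact: SM.
rewrite mulnBl mulnS addnCA subnK ?leq_mul2r; last first.
  by apply/orP; right; lia.
by rewrite addnC -divn_eq.
Qed.

Section Doeblin.
Context {R : realType} {T : finType}.
Variables (K : T -> T -> R) (S : set T) (pi0 : T -> R).
Hypothesis K_ge0 : forall x y, 0 <= K x y.
Hypothesis K_sum1 : forall x, \sum_y K x y = 1.
Hypothesis S_closed : forall x y, S x -> 0 < K x y -> S y.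
Hypothesis irreducible :
  forall x y, S x -> S y -> exists n, 0 < kernel_iter K n x y.
Hypothesis aperiodic : forall x, S x -> forall m,
  (forall n, (0 < n)%N -> 0 < kernel_iter K n x x -> (m %| n)%N) -> m = 1%N.
Hypothesis pi_ge0 : forall x, 0 <= pi0 x.
Hypothesis pi_sum1 : \sum_x pi0 x = 1.
Hypothesis pi_supp : forall x, ~ S x -> pi0 x = 0.
Hypothesis pi_inv : forall y, \sum_x pi0 x * K x y = pi0 y.

(* [K] is arbitrary off the state space [S]; restarting there from [pi0] makes
   Doeblin's condition hold at every state. *)
Definition restart_kernel (x y : T) : R := if `[< S x >] then K x y else pi0 y.

Lemma restart_kernel_ge0 x y : 0 <= restart_kernel x y.
Proof. by rewrite /restart_kernel; case: `[< S x >]. Qed.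

Lemma restart_kernel_sum1 x : \sum_y restart_kernel x y = 1.
Proof. by rewrite /restart_kernel; case: `[< S x >]. Qed.

Lemma restart_kernelE x y : S x -> restart_kernel x y = K x y.
Proof. by move=> Sx; rewrite /restart_kernel asboolT. Qed.

Lemma pi_restart_kernel x y : pi0 x * restart_kernel x y = pi0 x * K x y.
Proof.
have [Sx|/pi_supp ->] := pselect (S x); first by rewrite restart_kernelE.
by rewrite !mul0r.
Qed.

Lemma pi_restart_inv y : \sum_x pi0 x * restart_kernel x y = pi0 y.
Proof. by under eq_bigr do rewrite pi_restart_kernel. Qed.

Lemma pi_gt0_ex : exists x, 0 < pi0 x.
Proof.
apply: contrapT => nox; have : \sum_x pi0 x = 0.
  apply: big1 => x _; apply/eqP; rewrite eq_le pi_ge0 andbT leNgt.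
  by apply/negP => px; apply: nox; exists x.
by rewrite pi_sum1 => /eqP; rewrite oner_eq0.
Qed.

Lemma pi_kernel_iter n y : \sum_x pi0 x * kernel_iter K n x y = pi0 y.
Proof.
elim: n => [|n IH] /=.
  rewrite (bigD1 y) //= eqxx mulr1 big1 ?addr0 // => x /negPf ->.
  by rewrite mulr0.
under eq_bigr do rewrite mulr_sumr.
rewrite exchange_big /= -[RHS]IH; apply: eq_bigr => z _.
rewrite -[pi0 z]pi_inv mulr_suml.
by apply: eq_bigr => x _; rewrite mulrA.
Qed.

(** Some state carries mass, necessarily in [S]; irreducibility carries it to [x], and invariance
    keeps it in [pi0]. This is the source of absolute continuity with respect to the stationary
    law. *)
Lemma pi_gt0 x : S x -> 0 < pi0 x.
Proof.
move=> Sx; have [x0 px0] := pi_gt0_ex.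
have Sx0 : S x0 by apply: contrapT => /pi_supp p0; rewrite p0 ltxx in px0.
have [n Kn] := irreducible Sx0 Sx.
rewrite -(pi_kernel_iter n) (bigD1 x0) //= ltr_pwDl ?mulr_gt0 //.
by apply: sumr_ge0 => y _; rewrite mulr_ge0 // kernel_iter_ge0.
Qed.

Lemma kernel_iter_restart n x y : S x ->
  kernel_iter restart_kernel n x y = kernel_iter K n x y.
Proof.
elim: n x => [//|n IH] x Sx /=; apply: eq_bigr => z _.
rewrite restart_kernelE //.
have [->|Kz] := eqVneq (K x z) 0; first by rewrite !mul0r.
by rewrite IH //; apply: (S_closed Sx); rewrite lt_def Kz K_ge0.
Qed.

(** Aperiodicity at [w0] makes all long returns possible, so one common time serves every start in
    [S]; a start off [S] is redrawn from [pi0], which charges [w0], at the cost of one more step. *)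
Lemma restart_doeblin : exists m w0 eps,
  0 < eps /\ forall x, eps <= kernel_iter restart_kernel m x w0.
Proof.
have [w0 pw0] := pi_gt0_ex.
have Sw0 : S w0 by apply: contrapT => /pi_supp p0; rewrite p0 ltxx in pw0.
have [N HN] : exists N, forall n, (N <= n)%N -> 0 < kernel_iter K n w0 w0.
  apply: (additive_gcd1_cofinite (S := fun n => 0 < kernel_iter K n w0 w0)).
  - by rewrite /= eqxx.
  - move=> a b Ka Kb.
    by apply: lt_le_trans (kernel_iterD_ge K_ge0 a b w0 w0 w0); rewrite mulr_gt0.
  - exact: aperiodic.
have /choice[h hP] : forall x, exists n, S x -> 0 < kernel_iter K n x w0.
  move=> x.
  have [Sx|nSx] := pselect (S x); last by exists 0%N.
  by have [n Kn] := irreducible Sx Sw0; exists n.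
pose m := (N + \sum_x h x)%N.
have Km n x : (m <= n)%N -> S x -> 0 < kernel_iter K n x w0.
  move=> mn Sx; have hx : (h x <= \sum_x h x)%N by rewrite (bigD1 x) //= leq_addr.
  have hn : (N + h x <= n)%N by rewrite (leq_trans _ mn) // leq_add2l.
  have -> : n = (h x + (n - h x))%N by lia.
  apply: lt_le_trans (kernel_iterD_ge K_ge0 _ _ x w0 w0).
  by rewrite mulr_gt0 ?hP ?HN //; lia.
have pos x : 0 < kernel_iter restart_kernel m.+1 x w0.
  have [Sx|nSx] := pselect (S x); first by rewrite kernel_iter_restart // Km.
  rewrite /= /restart_kernel asboolF // -/restart_kernel (bigD1 w0) //=.
  rewrite ltr_pwDl // ?mulr_gt0 // ?kernel_iter_restart ?Km //.
  apply: sumr_ge0 => y _; rewrite mulr_ge0 // kernel_iter_ge0 //.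
  exact: restart_kernel_ge0.
(* The inverse of the sum of inverses is a positive lower bound of finitely many positive
   numbers. *)
exists m.+1, w0, (\sum_x (kernel_iter restart_kernel m.+1 x w0)^-1)^-1.
have sum_ge x : (kernel_iter restart_kernel m.+1 x w0)^-1 <=
    \sum_x (kernel_iter restart_kernel m.+1 x w0)^-1.
  rewrite (bigD1 x) //= lerDl sumr_ge0 // => y _.
  by rewrite invr_ge0; exact: ltW (pos y).
have sum_gt0 : 0 < \sum_x (kernel_iter restart_kernel m.+1 x w0)^-1.
  by apply: lt_le_trans (sum_ge w0); rewrite invr_gt0.
split; first by rewrite invr_gt0.
by move=> x; rewrite -[leRHS]invrK lef_pV2 ?posrE // invr_gt0.
Qed.

End Doeblin.

Lemma block_kernel_iterE (R : realType) (C : finType) k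
    (Q : k.-tuple C -> C -> R) n v v' :
  block_kernel_iter Q n v v' = kernel_iter (block_kernel Q) n v v'.
Proof. by elim: n v => //= n IH v; apply: eq_bigr => x _; rewrite IH. Qed.

Lemma block_kernel_ge0 (R : realType) (C : finType) k
    (Q : k.-tuple C -> C -> R) v v' :
  transition_probabilities Q -> 0 <= block_kernel Q v v'.
Proof. by move=> [Q_ge0 _]; exact: sumr_ge0. Qed.

Lemma block_kernel_sum1 (R : realType) (C : finType) k
    (Q : k.-tuple C -> C -> R) v :
  transition_probabilities Q -> \sum_v' block_kernel Q v v' = 1.
Proof.
move=> [_ Q_sum1]; rewrite /block_kernel -(Q_sum1 v).
rewrite [RHS](partition_big (fun c => [tuple of behead (rcons v c)]) predT) //=.
by apply: eq_bigr => v' _; apply: eq_bigl => c; rewrite eq_sym.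
Qed.

(** * Directed information increments *)

Section EntropyOfLaws.
Context {d : measure_display} {Omega : measurableType d} {R : realType}.
Variable P : probability Omega R.

Lemma probability_inhabited : exists w : Omega, True.
Proof.
apply: contrapT => now; have := probability_setT P.
rewrite (_ : setT = set0) ?measure0; last first.
  by apply/seteqP; split => w // _; apply: now; exists w.
by move=> /esym/eqP; rewrite onee_eq0.
Qed.

Lemma determined_factor (V W : Type) (H : Omega -> V) (G : Omega -> W) :
  (forall w w', H w = H w' -> G w = G w') -> exists phi, forall w, phi (H w) = G w.
Proof.
move=> det; have [w1 _] := probability_inhabited.
have /choice[phi phiE] : forall v, exists y, forall w, H w = v -> G w = y.
  move=> v; have [[w Hw]|noex] := pselect (exists w, H w = v).
    by exists (G w) => w' Hw'; apply: det; rewrite Hw.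
  by exists (G w1) => w Hw; case: noex; exists w.
by exists phi => w; rewrite -(phiE (H w) w).
Qed.

Section Pair.
Variables (U V : finType) (F : Omega -> U) (H : Omega -> V).
Hypothesis mF : forall u, measurable (F @^-1` [set u]).
Hypothesis mH : forall v, measurable (H @^-1` [set v]).

Lemma law_pairE u v :
  law P (fun w => (F w, H w)) (u, v) = fine (P (H @^-1` [set v] `&` F @^-1` [set u])).
Proof.
congr (fine (P _)).
by apply/seteqP; split => w /= [-> ->].
Qed.

Lemma law_snd v : law P H v = \sum_u law P (fun w => (F w, H w)) (u, v).
Proof.
rewrite -[LHS](_ : law P (fun w => (F w, H w).2) v = _) //.
rewrite (law_comp _ (measurable_fiberM mF mH)) /=.
rewrite (eq_bigr (fun p => law P (fun w => (F w, H w)) (p.1, p.2))); last by case.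
rewrite -(pair_big predT (pred1 v) (fun u v => law P (fun w => (F w, H w)) (u, v))) /=.
by apply: eq_bigr => u _; rewrite big_pred1_eq.
Qed.

Lemma law_pair_map (W : finType) (phi : V -> W) u y :
  law P (fun w => (F w, phi (H w))) (u, y) =
  \sum_(v | phi v == y) law P (fun w => (F w, H w)) (u, v).
Proof.
have := law_comp P (measurable_fiberM mF mH) (fun p => (p.1, phi p.2)) (u, y).
move=> /= ->.
rewrite (eq_bigr (fun p => law P (fun w => (F w, H w)) (p.1, p.2))); last by case.
rewrite (eq_bigl (fun p => (p.1 == u) && (phi p.2 == y))); last first.
  by move=> [u' v'] /=; rewrite xpair_eqE.
rewrite -(pair_big (pred1 u) (fun v => phi v == y)
  (fun u v => law P (fun w => (F w, H w)) (u, v))) /=.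
by rewrite big_pred1_eq.
Qed.

Lemma cond_entropy_law_reduce (W : finType) (G : Omega -> W) (rho : Omega -> U -> R) :
  (forall w w', H w = H w' -> G w = G w') ->
  (forall w w', G w = G w' -> rho w = rho w') ->
  (forall w0 u, fine (P (H @^-1` [set H w0] `&` F @^-1` [set u])) =
     law P H (H w0) * rho w0 u) ->
  cond_entropy (law P (fun w => (F w, H w))) =
  cond_entropy (law P (fun w => (F w, G w))).
Proof.
move=> /determined_factor[phi phiE] /determined_factor[r rE] step.
apply: (@cond_entropy_reduce _ _ _ _ phi _ _ (fun u y => r y u)).
- by move=> x; exact: law_ge0.
- move=> u y; rewrite -law_pair_map; congr (law P _ _).
  by apply/funext => w; rewrite phiE.
- move=> u v; rewrite -law_snd.
  have [v0|/law_neq0_ex[w <-]] := eqVneq (law P H v) 0.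
    rewrite v0 mulr0; apply: (congr1 fine (law_eq0_subset mH _ _ v0)).
      exact: measurable_fiberM.
    by move=> w /= [].
  by rewrite law_pairE step phiE rE mulrC.
Qed.

(** The two variables induce the same partition of the sample space, so among the values of [F]
    mapped to a given [v] at most one has positive probability. *)
Lemma entropy_law_equiv : (forall w w', F w = F w' <-> H w = H w') ->
  entropy (law P F) = entropy (law P H).
Proof.
move=> FH; have [phi phiE] : exists phi, forall w, phi (F w) = H w.
  by apply: determined_factor => w w' /FH.
rewrite /entropy; congr (- _); rewrite (partition_big phi predT) //=.
apply: eq_bigr => v _.
have HE : law P H v = \sum_(u | phi u == v) law P F u.
  rewrite -(law_comp P mF phi); congr (law P _ _).
  by apply/funext => w; rewrite phiE.
have [v0|/law_neq0_ex[w Hw]] := eqVneq (law P H v) 0.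
  rewrite v0 mul0r big1 // => u uv.
  suff -> : law P F u = 0 by rewrite mul0r.
  move: HE; rewrite v0 => /esym/psumr_eq0P; apply => // u' _; exact: law_ge0.
rewrite (bigD1 (F w)) /= ?phiE ?Hw // big1 ?addr0.
  by rewrite -Hw (eq_law_determined _ (G := H)) // => w'; exact: FH.
move=> u /andP[/eqP uv uF]; suff -> : law P F u = 0 by rewrite mul0r.
apply/eqP; apply: contraNT uF => /law_neq0_ex[w' Fw'].
rewrite -Fw'; apply/eqP/FH; by rewrite Hw -uv -Fw' phiE.
Qed.

End Pair.

End EntropyOfLaws.

Section DirectedInformationIncrements.
Context {d : measure_display} {Omega : measurableType d} {R : realType}.
Variables (P : probability Omega R) (A B : finType) (k : nat).
Variables (X : int -> Omega -> A) (Y : int -> Omega -> B).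

Let s0 : int := 1 - k%:Z.

Hypothesis mX : forall n : int, s0 <= n -> forall a, measurable (X n @^-1` [set a]).
Hypothesis mY : forall n : int, s0 <= n -> forall b, measurable (Y n @^-1` [set b]).

Definition block_law (t : int) : B * (k.+1.-tuple A * k.-tuple B) -> R :=
  law P (fun w => (Y t w, (window X (t - k%:Z) k.+1 w, window Y (t - k%:Z) k w))).

Let mWX (s : int) l v : s0 <= s -> measurable (window X s l @^-1` [set v]).
Proof. by move=> h; exact: (measurable_window mX). Qed.

Let mWY (s : int) l v : s0 <= s -> measurable (window Y s l @^-1` [set v]).
Proof. by move=> h; exact: (measurable_window mY). Qed.

Let s01 : s0 <= 1. Proof. rewrite /s0; lia. Qed.

Lemma measurable_pair_process (n : int) : s0 <= n ->
  forall c, measurable (pair_process X Y n @^-1` [set c]).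
Proof. by move=> h [a b]; apply: measurable_fiberM; [exact: mX|exact: mY]. Qed.

Lemma entropy_window0 : entropy (law P (window Y 1 0)) = 0.
Proof.
have nil_tuple (t : 0.-tuple B) : t = [tuple] by exact: tuple0.
have one : law P (window Y 1 0) [tuple] = 1.
  rewrite /law (_ : _ @^-1` _ = setT) ?probability_setT //.
  by apply/seteqP; split => w //= _; rewrite [LHS]nil_tuple.
rewrite /entropy big1 ?oppr0 // => t _.
by rewrite (nil_tuple t) one ln1 mulr0.
Qed.

Lemma entropy_window_increment m :
  entropy (law P (window Y 1 m.+1)) - entropy (law P (window Y 1 m)) =
  cond_entropy (law P (fun w => (Y m.+1%:Z w, window Y 1 m w))).
Proof.
have mYm b : measurable (Y m.+1%:Z @^-1` [set b]) by apply: mY; rewrite /s0; lia.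
have mW l v : measurable (window Y 1 l @^-1` [set v]) by exact: mWY.
rewrite cond_entropyE; last by move=> x; exact: law_ge0.
congr (_ - _); last by congr entropy; apply/funext => v; exact: (law_snd P mYm (@mW m)).
apply: (entropy_law_equiv P (@mW m.+1)) => w w'.
rewrite !window_rcons; have -> : 1 + m%:Z = m.+1%:Z by lia.
split=> [e|/pair_equal_spec[-> ->] //].
have [-> ->] : window Y 1 m w = window Y 1 m w' /\ Y m.+1%:Z w = Y m.+1%:Z w'.
  by case: (rcons_tuple_inj e).
by [].
Qed.

Section LargeTime.
Variable m : nat.
Hypothesis km : (k <= m)%N.

Let t : int := m.+1%:Z.

Let s0t : s0 <= t. Proof. rewrite /s0 /t; lia. Qed.
Let s0tk : s0 <= t - k%:Z. Proof. rewrite /s0 /t; lia. Qed.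
Let tE : s0 + (m + k)%N%:Z = t. Proof. rewrite /s0 /t; lia. Qed.
Let tkE : s0 + m%:Z = t - k%:Z. Proof. rewrite /s0 /t; lia. Qed.

(** Only the transition probability [q m] at this time enters, so [q] may vary with time; [k <= m]
    puts the last [k] values inside the window that starts at time 1. *)
Lemma output_cond_entropy (q : nat -> k.-tuple B -> B -> R) :
  markov_from P q Y s0 ->
  cond_entropy (law P (fun w => (Y t w, window Y 1 m w))) =
  cond_entropy (law P (fun w => (Y t w, window Y (t - k%:Z) k w))).
Proof.
move=> markov.
have sub w w' : window Y 1 m w = window Y 1 m w' ->
    window Y (t - k%:Z) k w = window Y (t - k%:Z) k w'.
  by apply: window_sub; rewrite /t; lia.
apply: (@cond_entropy_law_reduce _ _ _ P _ _ _ _ _ _ _ _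
  (fun w b => q m (window Y (t - k%:Z) k w) b)) => //.
- exact: mY.
- by move=> v; exact: mWY.
- by move=> w w' ->.
move=> w0 b.
have := markov_step_determined mY markov (G := window Y 1 m) (l := m) b w0.
rewrite tE tkE; apply => // w w'; apply: window_sub; rewrite /s0; lia.
Qed.

(** The Markov property gives the law of the pair at time [t] given the strict past [G]. Dividing by
    its marginal at [X t] gives the law of [Y t] given [H], that is, given the past and [X t]; it
    depends only on the last block and [X t]. *)
Lemma joint_cond_entropy (Q : k.-tuple (A * B) -> A * B -> R) :
  (forall v c, 0 <= Q v c) ->
  markov_from P (fun _ => Q) (pair_process X Y) s0 ->
  cond_entropy (law P (fun w => (Y t w, (window Y 1 m w, window X 1 m.+1 w)))) =
  cond_entropy (block_law t).
Proof.
move=> Q_ge0 markov.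
pose z w := window (pair_process X Y) (t - k%:Z) k w.
pose G w := (window Y 1 m w, window X 1 m w).
pose H w := (window Y 1 m w, window X 1 m.+1 w).
have mH v : measurable (H @^-1` [set v]).
  by apply: measurable_fiberM => ?; [exact: mWY|exact: mWX].
have HXt w w' : H w = H w' -> X t w = X t w'.
  by move=> /pair_equal_spec[_ e]; apply: (window_last _ _ e); rewrite /t; lia.
have HG w w' : H w = H w' -> G w = G w'.
  by move=> /pair_equal_spec[eY eX]; rewrite /G eY; congr pair; apply: (window_sub _ _ eX); lia.
have Gz w w' : G w = G w' -> z w = z w'.
  move=> /pair_equal_spec[eY eX]; apply/window_pairP.
  by split; [apply: (window_sub _ _ eX)|apply: (window_sub _ _ eY)]; rewrite /t; lia.
have joint w0 b : fine (P (H @^-1` [set H w0] `&` Y t @^-1` [set b])) =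
    law P G (G w0) * Q (z w0) (X t w0, b).
  have := markov_step_determined measurable_pair_process markov (G := G) (l := m)
    (X t w0, b) w0.
  rewrite tE tkE => <- //; last first.
    move=> w w' /window_pairP[eX eY].
    by congr pair; [apply: (window_sub _ _ eY)|apply: (window_sub _ _ eX)];
      rewrite /s0; lia.
  congr (fine (P _)); apply/seteqP; split => w /= [e1 e2]; split.
  - exact: HG.
  - by rewrite /pair_process e2 (HXt _ _ e1).
  - rewrite /H !window_rcons; move/pair_equal_spec: e1 => [-> ->].
    by case: e2; have -> : 1 + m%:Z = t by [rewrite /t; lia]; move=> -> _.
  - by case: e2.
have marg w0 : law P H (H w0) = law P G (G w0) * \sum_b Q (z w0) (X t w0, b).
  rewrite (law_snd _ (mY s0t) mH) mulr_sumr; apply: eq_bigr => b _.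
  by rewrite law_pairE joint.
apply: (@cond_entropy_law_reduce _ _ _ P _ _ _ H _ _ _ _
  (fun w b => Q (z w) (X t w, b) / \sum_b' Q (z w) (X t w, b'))) => //.
- exact: mY.
- move=> w w' /pair_equal_spec[eY eX]; congr pair.
    by apply: (window_sub _ _ eX); rewrite /t; lia.
  by apply: (window_sub _ _ eY); rewrite /t; lia.
- move=> w w' /pair_equal_spec[eX eY].
  have -> : z w = z w'.
    apply/window_pairP; split => //; apply: (window_sub _ _ eX); lia.
  by rewrite (window_last _ _ eX) //; rewrite /t; lia.
move=> w0 b; rewrite joint marg -mulrA; congr (_ * _).
(* If [X t w0] has conditional probability 0, every numerator is 0 as well. *)
have [S0|Sn0] := eqVneq (\sum_b' Q (z w0) (X t w0, b')) 0.
  rewrite S0 mul0r; apply: (psumr_eq0P _ S0) => // b' _; exact: Q_ge0.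
by rewrite mulrC divfK.
Qed.

Lemma block_law_cond_info :
  cond_mutual_info (block_law t) =
  cond_entropy (law P (fun w => (Y t w, window Y (t - k%:Z) k w)))
  - cond_entropy (block_law t).
Proof.
rewrite /cond_mutual_info; congr (cond_entropy _ - _); apply/funext => -[b y] /=.
have mH v : measurable
    ((fun w => (window X (t - k%:Z) k.+1 w, window Y (t - k%:Z) k w)) @^-1` [set v]).
  by apply: measurable_fiberM => ?; [exact: mWX|exact: mWY].
rewrite (law_pair_map P (mY s0t) mH snd) /=.
rewrite [RHS](eq_bigr (fun p => block_law t (b, (p.1, p.2)))); last by case.
rewrite -(pair_big predT (pred1 y) (fun x y => block_law t (b, (x, y)))) /=.
by apply: eq_bigr => x _; rewrite big_pred1_eq.
Qed.

End LargeTime.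

Lemma directed_info_increments n : directed_info P X Y n = \sum_(0 <= m < n)
  (cond_entropy (law P (fun w => (Y m.+1%:Z w, window Y 1 m w)))
   - cond_entropy (law P (fun w =>
       (Y m.+1%:Z w, (window Y 1 m w, window X 1 m.+1 w))))).
Proof.
rewrite /directed_info big_add1 sumrB; congr (_ - _).
under eq_bigr do rewrite -entropy_window_increment.
by rewrite telescope_sumr // entropy_window0 subr0.
Qed.

End DirectedInformationIncrements.

Lemma eventually_le_bigO (R : realType) (f g : nat -> R) (C : R) (N : nat) :
  (forall n, (N <= n)%N -> `|f n| <= C * g n) -> f =O_\oo g.
Proof.
move=> fg; apply/eqO_exP; exists (`|C| + 1); first by rewrite ltr_wpDl.
exists N => // n /= /fg le_fg; apply: le_trans le_fg _.
apply: le_trans (ler_norm _) _; rewrite normrM ler_wpM2r // lerDl //.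
Qed.

Lemma cvg_sumr (R : realType) (I : Type) (r : seq I) (f : I -> nat -> R) (a : I -> R) :
  (forall i, f i n @[n --> \oo] --> a i) ->
  \sum_(i <- r) f i n @[n --> \oo] --> \sum_(i <- r) a i.
Proof.
by move=> fa; apply: cvg_big => //; exact: add_continuous.
Qed.

(** * Blocks of length k + 1 as transitions between blocks of length k *)

Section BlockTriple.
Variables (A B : finType) (k : nat).

(** For [i] the last index, the second of two overlapping [k]-blocks contributes only its newest
    symbol; the statistic of the estimator thus becomes a function of one transition of the block
    chain. *)
Definition block_triple (i : 'I_k) (p : k.-tuple (A * B) * k.-tuple (A * B)) :
    B * (k.+1.-tuple A * k.-tuple B) :=
  ((tnth p.2 i).2, ([tuple of rcons [tuple of map fst p.1] (tnth p.2 i).1],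
    [tuple of map snd p.1])).

Lemma block_triple_window (Omega : Type) (X : int -> Omega -> A)
    (Y : int -> Omega -> B) (i : 'I_k) (s : int) w : i.+1 = k ->
  block_triple i (window (pair_process X Y) s k w,
                  window (pair_process X Y) (s + 1) k w) =
  (Y (s + k%:Z) w, (window X s k.+1 w, window Y s k w)).
Proof.
move=> ik; rewrite /block_triple tnth_mktuple window_fst window_snd window_rcons.
by have -> : s + 1 + i%:Z = s + k%:Z by lia.
Qed.

End BlockTriple.

Section BlockLaw.
Context {d : measure_display} {Omega : measurableType d} {R : realType}.
Variables (P : probability Omega R) (C : finType) (k : nat).
Variables (Q : k.-tuple C -> C -> R) (V : int -> Omega -> C) (s : int).
Hypothesis mV : forall n, s <= n -> forall c, measurable (V n @^-1` [set c]).
Hypothesis markov : markov_from P (fun _ => Q) V s.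

Lemma block_pair_law l x y :
  law P (fun w => (window V (s + l%:Z) k w, window V (s + l%:Z + 1) k w)) (x, y) =
  law P (window V (s + l%:Z) k) x * block_kernel Q x y.
Proof.
have mW o v : measurable (window V (s + l%:Z + o%:Z) k @^-1` [set v]).
  by apply: (measurable_window mV); lia.
have mx v : measurable (window V (s + l%:Z) k @^-1` [set v]).
  by have := mW 0%N v; rewrite addr0.
have [x0|/law_neq0_ex[w <-]] := eqVneq (law P (window V (s + l%:Z) k) x) 0.
  rewrite x0 mul0r; apply: (congr1 fine (law_eq0_subset mx _ _ x0)).
    by apply: measurable_fiberM => // v; exact: (mW 1%N).
  by move=> w /= /pair_equal_spec[].
rewrite -(block_step (G := window V (s + l%:Z) k) _ _ mV markov) //.
  congr (fine (P _)).
  by apply/seteqP; split => w' /= => [/pair_equal_spec[-> ->]//|[-> ->]].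
by move=> w1 w2; apply: window_sub; lia.
Qed.

Lemma block_pair_map_law l (T : finType)
    (phi : k.-tuple C * k.-tuple C -> T) t :
  law P (fun w => phi (window V (s + l%:Z) k w, window V (s + l%:Z + 1) k w)) t =
  \sum_x \sum_y law P (window V (s + l%:Z) k) x * block_kernel Q x y
    * (phi (x, y) == t)%:R.
Proof.
have mW o v : measurable (window V (s + l%:Z + o%:Z) k @^-1` [set v]).
  by apply: (measurable_window mV); lia.
have mx v : measurable (window V (s + l%:Z) k @^-1` [set v]).
  by have := mW 0%N v; rewrite addr0.
rewrite (law_comp P (measurable_fiberM mx (mW 1%N)) phi) big_mkcond sum_pairE.
apply: eq_bigr => x _; apply: eq_bigr => y _.
by rewrite block_pair_law; case: ifP; rewrite ?mulr1 ?mulr0.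
Qed.

End BlockLaw.

(** * Rates of the plug-in estimator *)

Section PlugInRates.
Context {R : realType} {A B : finType}.
Variable k : nat.
Hypothesis hk : (1 <= k)%N.
Context {d : measure_display} {Omega : measurableType d}.
Variable P : probability Omega R.
Variables (X : int -> Omega -> A) (Y : int -> Omega -> B).
Hypothesis mX : forall n : int, 1 - k%:Z <= n -> forall a, measurable (X n @^-1` [set a]).
Hypothesis mY : forall n : int, 1 - k%:Z <= n -> forall b, measurable (Y n @^-1` [set b]).
Variable Q : k.-tuple (A * B) -> A * B -> R.
Hypothesis hQ : transition_probabilities Q.
Let V := pair_process X Y.
Hypothesis hmarkov : markov_from P (fun _ => Q) V (1 - k%:Z).
Let S := visited P V : set (k.-tuple (A * B)).
Hypothesis hirr : irreducible_on Q S.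
Hypothesis haper : aperiodic_on Q S.
Context {d' : measure_display} {Omega' : measurableType d'}.
Variable P' : probability Omega' R.
Variables (Xbar : int -> Omega' -> A) (Ybar : int -> Omega' -> B).
Let Vbar := pair_process Xbar Ybar.
Hypothesis hbar : stationary_version P' Q S Vbar.

Let K := block_kernel Q.
Let pi0 := law P' (window Vbar (1 - k%:Z) k).
Let K' := restart_kernel K S pi0.
Let Z (n : nat) := window V (n%:Z - k%:Z + 1) k.
Let H (n : nat) := window V (1 - k%:Z) (n + k).

Let mV : forall n : int, 1 - k%:Z <= n -> forall c, measurable (V n @^-1` [set c]).
Proof. exact: measurable_pair_process. Qed.

Let mH n u : measurable (H n @^-1` [set u]).
Proof. exact: (measurable_window mV). Qed.

Let mZ n u : measurable (Z n @^-1` [set u]).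
Proof. by apply: (measurable_window mV); lia. Qed.

Let H_det n w w' : H n w = H n w' -> forall j, (j <= n)%N -> Z j w = Z j w'.
Proof. by move=> e j jn; apply: (window_sub _ _ e); lia. Qed.

Let ZE n : Z n = window V (1 - k%:Z + n%:Z) k.
Proof. by rewrite /Z; congr (window V _ k); lia. Qed.

Let ZSE n : Z n.+1 = window V (1 - k%:Z + n%:Z + 1) k.
Proof. by rewrite /Z; congr (window V _ k); lia. Qed.

Let mZ_pair n u : measurable ((fun w => (Z n w, Z n.+1 w)) @^-1` [set u]).
Proof. by apply: measurable_fiberM => v; exact: mZ. Qed.

Let pair_law n x y :
  law P (fun w => (Z n w, Z n.+1 w)) (x, y) = law P (Z n) x * K x y.
Proof. by rewrite (ZE n) (ZSE n) (block_pair_law mV hmarkov). Qed.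

Let K_ge0 x y : 0 <= K x y. Proof. exact: block_kernel_ge0. Qed.
Let K_sum1 x : \sum_y K x y = 1. Proof. exact: block_kernel_sum1. Qed.

Let S_or_null n x : S x \/ law P (Z n) x = 0.
Proof.
have [x0|xn0] := eqVneq (law P (Z n) x) 0; [by right|left].
by exists n; rewrite lt_def xn0 law_ge0.
Qed.

Let S_closed x y : S x -> 0 < K x y -> S y.
Proof.
move=> [n xn] Kxy; exists n.+1; rewrite lt_def law_ge0 andbT.
apply/eqP => y0; have := pair_law n x y.
have -> : law P (fun w => (Z n w, Z n.+1 w)) (x, y) = 0.
  apply: (congr1 fine (law_eq0_subset (mZ n.+1) _ _ y0)) => //.
  by move=> w /= /pair_equal_spec[].
by move/eqP; rewrite eq_sym mulf_eq0 !gt_eqF.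
Qed.

Let irreducible x y : S x -> S y -> exists n, 0 < kernel_iter K n x y.
Proof.
by move=> Sx Sy; have [n] := hirr Sx Sy; exists n; rewrite -block_kernel_iterE.
Qed.

Let aperiodic x : S x -> forall m, (forall n, (0 < n)%N ->
  0 < kernel_iter K n x x -> (m %| n)%N) -> m = 1%N.
Proof.
move=> Sx m hm; apply: (haper Sx) => n n0; rewrite block_kernel_iterE; exact: hm.
Qed.

Let pi_ge0 x : 0 <= pi0 x. Proof. exact: law_ge0. Qed.
Let pi_sum1 : \sum_x pi0 x = 1. Proof. by have [_ _ _ []] := hbar. Qed.
Let pi_supp x : ~ S x -> pi0 x = 0. Proof. by have [_ _ _ [_ _ h _]] := hbar; exact: h. Qed.
Let pi_inv y : \sum_x pi0 x * K x y = pi0 y.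
Proof. by have [_ _ _ [_ _ _ h]] := hbar; exact: h. Qed.

Let K'_ge0 x y : 0 <= K' x y. Proof. exact: restart_kernel_ge0. Qed.
Let K'_sum1 x : \sum_y K' x y = 1. Proof. exact: restart_kernel_sum1. Qed.
Let pi_inv' y : \sum_x pi0 x * K' x y = pi0 y. Proof. exact: pi_restart_inv. Qed.

(** The restarted kernel describes the same process: it agrees with [K] on visited blocks, and a
    history ending off [S] has probability 0. *)
Let step n w0 y : fine (P (H n @^-1` [set H n w0] `&` Z n.+1 @^-1` [set y])) =
  law P (H n) (H n w0) * K' (Z n w0) y.
Proof.
have -> : fine (P (H n @^-1` [set H n w0] `&` Z n.+1 @^-1` [set y])) =
    law P (H n) (H n w0) * K (Z n w0) y.
  rewrite (ZE n) (ZSE n); apply: (block_step _ _ mV hmarkov) => // w w' e.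
  by rewrite -(ZE n); exact: (H_det e).
case: (S_or_null n (Z n w0)) => [Sx|null]; first by rewrite /K' restart_kernelE.
suff -> : law P (H n) (H n w0) = 0 by rewrite !mul0r.
apply: (congr1 fine (law_eq0_subset (mZ n) _ _ null)) => // w /= e.
exact: (H_det e).
Qed.

Let last_index : exists i : 'I_k, i.+1 = k.
Proof.
have h : (k.-1 < k)%N by rewrite prednK.
by exists (Ordinal h); rewrite /= prednK.
Qed.

Let i := sval (cid last_index).
Let ik : i.+1 = k := svalP (cid last_index).

Let p0 := block_law (k := k) P' Xbar Ybar 0.

Let p0E t : p0 t =
  \sum_x \sum_y pi0 x * K x y * (block_triple i (x, y) == t)%:R.
Proof.
have [mVbar stat markov_bar _] := hbar.
have := @block_pair_map_law _ _ _ P' _ k Q Vbar (- k%:Z) (fun n _ => mVbar n)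
  (markov_bar _) 0 _ (block_triple i) t.
(* Stationarity carries the law of the block starting at [- k] to that of the block starting at
   [1 - k], which is [pi0]. *)
rewrite addr0; under [X in _ = X -> _]eq_bigr do under eq_bigr do
  rewrite stat -(stat (1 - k%:Z)).
move=> <-; rewrite /p0 /block_law; congr (law P' _ t); apply/funext => w.
by rewrite block_triple_window // add0r addNr.
Qed.

Let triple_law n t :
  law P (fun w => block_triple i (Z n w, Z n.+1 w)) t =
  \sum_x \sum_y law P (Z n) x * K x y * (block_triple i (x, y) == t)%:R.
Proof. by rewrite (ZE n) (ZSE n) (block_pair_map_law mV hmarkov). Qed.

Let tripleE n w : block_triple i (Z n w, Z n.+1 w) =
  (Y n.+1%:Z w, (window X (n.+1%:Z - k%:Z) k.+1 w, window Y (n.+1%:Z - k%:Z) k w)).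
Proof.
have -> : Z n = window V (n.+1%:Z - k%:Z) k by rewrite /Z; congr (window V _ k); lia.
by rewrite block_triple_window // subrK.
Qed.

Let block_lawE n t : block_law (k := k) P X Y n.+1%:Z t =
  \sum_x \sum_y law P (Z n) x * K x y * (block_triple i (x, y) == t)%:R.
Proof.
rewrite -triple_law; congr (law P _ t); apply/funext => w; exact/esym/tripleE.
Qed.

(** Visited blocks have positive [pi0]-mass, so a triple of stationary probability 0 can arise from
    them only through transitions of probability 0. *)
Let block_law_abs_cont n t : p0 t = 0 -> block_law (k := k) P X Y n.+1%:Z t = 0.
Proof.
rewrite p0E block_lawE => p0t; apply: big1 => x _; apply: big1 => y _.
case: (S_or_null n x) => [Sx|->]; last by rewrite !mul0r.
have term_ge0 x' y' : 0 <= pi0 x' * K x' y' * (block_triple i (x', y') == t)%:R.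
  by rewrite !mulr_ge0.
have inner0 : \sum_y pi0 x * K x y * (block_triple i (x, y) == t)%:R = 0.
  by apply: (psumr_eq0P _ p0t) => // x' _; apply: sumr_ge0.
have : pi0 x * K x y * (block_triple i (x, y) == t)%:R = 0.
  exact: (psumr_eq0P _ inner0).
have px : pi0 x != 0.
  by rewrite gt_eqF // (pi_gt0 K_ge0 irreducible pi_ge0 pi_sum1 pi_supp pi_inv).
by rewrite -!mulrA => /eqP; rewrite mulf_eq0 (negPf px) /= => /eqP ->; rewrite mulr0.
Qed.

Let Ibar := cond_info0 P' Xbar Ybar k.

Let IbarE : Ibar = cond_mutual_info p0.
Proof.
rewrite /Ibar /cond_info0 /p0 /block_law; congr (cond_mutual_info (law P' _)).
by apply/funext => w; rewrite !add0r.
Qed.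

Let p0_ge0 t : 0 <= p0 t. Proof. exact: law_ge0. Qed.

Let doeblin : exists m w0 eps, 0 < eps /\ forall x, eps <= kernel_iter K' m x w0.
Proof.
exact: (restart_doeblin K_ge0 S_closed irreducible aperiodic pi_ge0 pi_sum1 pi_supp).
Qed.

Let avg t n w : R := n%:R^-1 *
  \sum_(0 <= j < n) (block_triple i (Z j w, Z j.+1 w) == t)%:R.

Let mean_p0 t :
  \sum_x \sum_y pi0 x * K' x y * (block_triple i (x, y) == t)%:R = p0 t.
Proof.
rewrite p0E; apply: eq_bigr => x _; apply: eq_bigr => y _.
by rewrite /K' pi_restart_kernel.
Qed.

Let pluginE n w : plugin X Y k n w = cond_mutual_info (fun t => avg t n w).
Proof.
rewrite /plugin; congr cond_mutual_info; apply/funext => -[b [a y]].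
rewrite /empirical /avg big_add1 /=; congr (_ * _); apply: eq_bigr => j _.
rewrite tripleE !xpair_eqE; congr (_%:R); congr nat_of_bool.
rewrite [in LHS](window_rcons Y) subrK.
have -> : ([tuple of rcons (window Y (j.+1%:Z - k%:Z) k w) (Y j.+1 w)] ==
    [tuple of rcons y b]) = (window Y (j.+1%:Z - k%:Z) k w == y) && (Y j.+1 w == b).
  apply/eqP/andP => [e|[/eqP -> /eqP -> //]].
  by have [-> ->] := rcons_tuple_inj e.
by rewrite andbA andbC.
Qed.

Let plugin_det n w w' : H n w = H n w' -> plugin X Y k n w = plugin X Y k n w' :> R.
Proof.
move=> e; rewrite !pluginE; congr cond_mutual_info; apply/funext => t.
rewrite /avg !big_nat; congr (_ * _); apply: eq_bigr => j /= jn.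
by rewrite !(H_det e) // ltnW.
Qed.

(** Absolute continuity of all empirical laws at once, as the Lipschitz bound demands. *)
Let ae_supported :
  {ae P, forall w, forall n, p0 (block_triple i (Z n w, Z n.+1 w)) != 0}.
Proof.
apply: ae_foralln => n.
pose E p := p0 (block_triple i p) == 0.
exists ((fun w => (Z n w, Z n.+1 w)) @^-1` [set p | E p]); split.
- exact: (measurable_preimage_fin (@mZ_pair n)).
- apply: (etrans (prob_preimage_fin P (@mZ_pair n) E)); rewrite big1 // => -[x y] /eqP xy0; rewrite pair_law.
  apply/eqP; have /eqP := block_law_abs_cont n xy0.
  rewrite block_lawE psumr_eq0; last first.
    by move=> x' _; apply: sumr_ge0 => y' _; rewrite !mulr_ge0 // law_ge0.
  move=> /allP/(_ x (mem_index_enum _)) /=.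
  rewrite psumr_eq0; last by move=> y' _; rewrite !mulr_ge0 // law_ge0.
  by move=> /allP/(_ y (mem_index_enum _)) /=; rewrite eqxx mulr1.
- by move=> w /= /negP; rewrite negbK.
Qed.

Let info_lipschitz : exists2 C : R, 0 <= C & forall p, (forall t, 0 <= p t <= 1) ->
  (forall t, p0 t = 0 -> p t = 0) ->
  `|cond_mutual_info p - Ibar| <= C * \sum_t `|p t - p0 t|.
Proof. by rewrite IbarE; exact: cond_mutual_info_lipschitz. Qed.

Let avg01 t n w : (0 < n)%N -> 0 <= avg t n w <= 1.
Proof.
move=> n0; have nR : 0 < n%:R :> R by rewrite ltr0n.
rewrite /avg mulr_ge0 ?invr_ge0 ?sumr_ge0 //= ler_pdivrMl // mulr1.
rewrite (le_trans (ler_sum _ (fun j _ => _ : _ <= 1))) //.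
  by move=> j _; case: (_ == t).
by rewrite sumr_const_nat subn0.
Qed.

Let plugin_le : exists2 C : R, 0 <= C & {ae P, forall w, forall n, (0 < n)%N ->
  `|plugin X Y k n w - Ibar| <= C * \sum_t `|avg t n w - p0 t|}.
Proof.
have [C C_ge0 lip] := info_lipschitz; exists C => //.
apply: filterS ae_supported => w supp n n0; rewrite pluginE.
apply: lip => [t|t p0t]; first exact: avg01.
rewrite /avg big1 ?mulr0 // => j _; case: eqP => // e.
by have := supp j; rewrite e p0t eqxx.
Qed.

Lemma plugin_rate_as : {ae P, forall w, (fun n => plugin X Y k n w - Ibar : R)
  =O_\oo (fun n => Num.sqrt (ln (ln n%:R) / n%:R) : R)}.
Proof.
have [m [w0 [eps [eps0 dob]]]] := doeblin.
have avg_as t := ergodic_average_as K'_ge0 K'_sum1 mH H_det step eps0 dob pi_sum1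
  pi_inv' (fun x y => (block_triple i (x, y) == t)%:R).
have /choice[c cP] := avg_as.
have [C C_ge0 bound] := plugin_le.
have all_t : {ae P, forall w, forall t, exists N, forall n, (N <= n)%N ->
    `|avg t n w - p0 t| <= c t * Num.sqrt (ln (ln n%:R) / n%:R)}.
  by apply: filter_forall => t; rewrite -mean_p0; exact: cP.
apply: filterS2 bound all_t => w plug /choice[N NP].
(* The sum of the thresholds dominates each of them; the successor ensures [0 < n]. *)
apply: (@eventually_le_bigO _ _ _ (C * \sum_t c t) (\sum_t N t).+1) => n nN.
apply: le_trans (plug n _) _; first by apply: leq_trans nN.
rewrite -mulrA ler_wpM2l // mulr_suml ler_sum // => t _; apply: NP.
by apply: leq_trans (ltnW nN); rewrite (bigD1 t) //= leq_addr.
Qed.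

Let mplugin n : measurable_fun setT (fun w => plugin X Y k n w : R).
Proof.
move=> _ D mD; rewrite setTI.
exact: (measurable_determined (@mH n) D (@plugin_det n)).
Qed.

Let mavg t n : measurable_fun setT (fun w => avg t n w).
Proof.
move=> _ D mD; rewrite setTI.
apply: (measurable_determined (@mH n)) => w w' e.
rewrite /avg !big_nat; congr (_ * _); apply: eq_bigr => j /= jn.
by rewrite !(H_det e) // ltnW.
Qed.

Lemma plugin_rate_L1 :
  (fun n => fine ('E_P[(fun w => `|plugin X Y k n w - Ibar|)%R])%E : R)
    =O_\oo (fun n => (Num.sqrt n%:R)^-1 : R).
Proof.
have [m [w0 [eps [eps0 dob]]]] := doeblin.
have avg_L1 t := ergodic_average_L1 K'_ge0 K'_sum1 mH H_det step eps0 dob pi_sum1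
  pi_inv' (fun x y => (block_triple i (x, y) == t)%:R).
have /choice[c cP] : forall t, exists c : R, forall n,
    (\int[P]_w (`|avg t n.+1 w - p0 t|)%:E <= (c / Num.sqrt n.+1%:R)%:E)%E.
  by move=> t; have [c _ cP] := avg_L1 t; exists c; rewrite -mean_p0.
have [C C_ge0 bound] := plugin_le.
apply: (@eventually_le_bigO _ _ _ (C * \sum_t c t) 1) => -[//|n] _.
set I := ('E_P[_])%E.
have I_ge0 : (0 <= I)%E by apply: expectation_ge0.
have mabs t : measurable_fun setT (fun w => (`|avg t n.+1 w - p0 t|)%:E).
  apply/measurable_EFinP; apply: measurableT_comp => //.
  exact: measurable_funB.
have I_le : (I <= (C * (\sum_t c t) / Num.sqrt n.+1%:R)%:E)%E.
  rewrite /I unlock.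
  apply: (@le_trans _ _ (\int[P]_w (C%:E * \sum_t (`|avg t n.+1 w - p0 t|)%:E))%E).
    apply: ae_ge0_le_integral => //.
    - apply/measurable_EFinP; apply: measurableT_comp => //.
      exact: measurable_funB.
    - by move=> w _; rewrite mule_ge0 ?lee_fin // sume_ge0.
    - by apply: measurable_funeM; apply: emeasurable_sum.
    - apply: filterS bound => w plug _.
      by rewrite sumEFin -EFinM lee_fin plug.
  rewrite ge0_integralZl_EFin //; last 2 first.
  - by move=> w _; rewrite sume_ge0.
  - exact: emeasurable_sum.
  rewrite ge0_integral_sum // -mulrA EFinM lee_wpmul2l ?lee_fin //.
  by rewrite mulr_suml -sumEFin lee_sum.
(* On an infinite expectation [fine] would return 0, so finiteness has to be checked. *)
have I_fin : I \is a fin_num.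
  by rewrite ge0_fin_numE // (le_lt_trans I_le) // ltry.
rewrite ger0_norm ?fine_ge0 // -lee_fin fineK //.
Qed.

Hypothesis hY : exists q, markov_from (k := k) P q Y (1 - k%:Z).

Lemma directed_info_mean_cvg : directed_info_mean P X Y @ \oo --> Ibar.
Proof.
have [q markovY] := hY.
have [m0 [w0 [eps [eps0 dob]]]] := doeblin.
have lawZ x : law P (Z n) x @[n --> \oo] --> pi0 x.
  apply: (law_cvg_invariant K'_ge0 K'_sum1 eps0 dob pi_ge0 pi_sum1 pi_inv'
    (mu := fun n => law P (Z n))).
  - by move=> y; exact: law_ge0.
  - exact: (law_sum1 P (@mZ 0)).
  - move=> n y; rewrite (law_snd P (@mZ n) (@mZ n.+1)).
    apply: eq_bigr => z _; rewrite pair_law.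
    case: (S_or_null n z) => [Sz|->]; last by rewrite !mul0r.
    by rewrite /K' restart_kernelE.
have block_cvg t : block_law (k := k) P X Y n.+1%:Z t @[n --> \oo] --> p0 t.
  rewrite p0E; under eq_fun do rewrite block_lawE.
  apply: cvg_sumr => x; apply: cvg_sumr => y.
  by apply: cvgMr_tmp; apply: cvgMr_tmp.
have info_cvg : cond_mutual_info (block_law (k := k) P X Y n.+1%:Z)
    @[n --> \oo] --> Ibar.
  have [C C_ge0 lip] := info_lipschitz.
  have dist_cvg : C * \sum_t `|block_law (k := k) P X Y n.+1%:Z t - p0 t|
      @[n --> \oo] --> (0 : R).
    rewrite -[X in _ --> X](mulr0 C); apply: cvgMl_tmp.
    have self0 : \sum_t `|p0 t - p0 t| = 0.
      by apply: big1 => t _; rewrite subrr normr0.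
    rewrite -[X in _ --> X]self0.
    apply: cvg_sumr => t; apply: cvg_norm; apply: cvgB => //; exact: cvg_cst.
  apply/cvgrPdist_le => e e0; move/cvgrPdist_le: dist_cvg => /(_ e e0)[N _ HN].
  exists N => // n /HN /=; rewrite sub0r normrN ger0_norm; last first.
    by rewrite mulr_ge0 // sumr_ge0.
  apply: le_trans; rewrite distrC; apply: lip => [t|t]; last exact: block_law_abs_cont.
  rewrite /block_law law_ge0 law_le1 // => v.
  apply: measurable_fiberM => u; first by apply: mY; lia.
  apply: measurable_fiberM => u'; first by apply: (measurable_window mX); lia.
  by apply: (measurable_window mY); lia.
pose a m := cond_entropy (law P (fun w => (Y m.+1%:Z w, window Y 1 m w)))
  - cond_entropy (law P (fun w =>
       (Y m.+1%:Z w, (window Y 1 m w, window X 1 m.+1 w)))).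
have a_cvg : a @ \oo --> Ibar.
  (* The increment is identified from [m = k] on; the first [k] increments do not affect the
     limit. *)
  apply: cvg_trans info_cvg; apply: near_eq_cvg; exists k => // m km /=.
  rewrite /a (output_cond_entropy mY km markovY).
  have [Q_ge0 _] := hQ.
  by rewrite (joint_cond_entropy mX mY km Q_ge0 hmarkov) (block_law_cond_info P mX mY km).
(* The arithmetic mean of index [n] averages the first [n + 1] increments, hence the shift. *)
have := cesaro a_cvg; rewrite -[in X in _ -> X]cvg_shiftS.
apply: cvg_trans; apply: near_eq_cvg; apply: nearW => n.
rewrite /directed_info_mean /= (directed_info_increments P X mY) mulrC.
by rewrite /arithmetic_mean /series.
Qed.

End PlugInRates.

Theorem corollary3p4 (R : realType) (A B : finType) (k : nat) (hk : (1 <= k)%N)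
  (d : measure_display) (Omega : measurableType d) (P : probability Omega R)
  (X : int -> Omega -> A) (Y : int -> Omega -> B)
  (mX : forall n : int, 1 - k%:Z <= n -> forall a, measurable (X n @^-1` [set a]))
  (mY : forall n : int, 1 - k%:Z <= n -> forall b, measurable (Y n @^-1` [set b]))
  (Q : k.-tuple (A * B) -> A * B -> R)
  (hQ : transition_probabilities Q)
  (hmarkov : markov_from P (fun _ => Q) (pair_process X Y) (1 - k%:Z))
  (hirr : irreducible_on Q (visited P (pair_process X Y)))
  (haper : aperiodic_on Q (visited P (pair_process X Y)))
  (d' : measure_display) (Omega' : measurableType d') (P' : probability Omega' R)
  (Xbar : int -> Omega' -> A) (Ybar : int -> Omega' -> B)
  (hbar : stationary_version P' Q (visited P (pair_process X Y))
            (pair_process Xbar Ybar)) :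
  let rate_as : nat -> R := fun n => Num.sqrt (ln (ln n%:R) / n%:R) in
  let rate_L1 : nat -> R := fun n => (Num.sqrt n%:R)^-1 in
  let Ibar : R := cond_info0 P' Xbar Ybar k in
  let Irate : R := directed_info_rate P X Y in
  [/\ {ae P, forall w,
        (fun n => plugin X Y k n w - Ibar : R) =O_\oo rate_as},
      (fun n => fine ('E_P[(fun w => `|plugin X Y k n w - Ibar|)%R])%E : R)
        =O_\oo rate_L1 &
      (exists q, markov_from (k := k) P q Y (1 - k%:Z)) ->
      [/\ cvgn (directed_info_mean P X Y),
          {ae P, forall w,
            (fun n => plugin X Y k n w - Irate : R) =O_\oo rate_as} &
          (fun n => fine ('E_P[(fun w => `|plugin X Y k n w - Irate|)%R])%E : R)
            =O_\oo rate_L1]].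
Proof.
move=> rate_as rate_L1 Ibar Irate.
have cvg_rate (hY : exists q, markov_from (k := k) P q Y (1 - k%:Z)) :
    directed_info_mean P X Y @ \oo --> Ibar.
  exact: (directed_info_mean_cvg hk mX mY hQ hmarkov hirr haper hbar hY).
have as_rate := plugin_rate_as hk mX mY hQ hmarkov hirr haper hbar.
have L1_rate := plugin_rate_L1 hk mX mY hQ hmarkov hirr haper hbar.
split=> // /cvg_rate rate.
have -> : Irate = Ibar by apply: cvg_lim.
by split=> //; apply/cvg_ex; exists Ibar.
Qed.
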